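(* Let $\mathcal D=(V,E)$ be a directed acyclic graph on $V=\{1,\dots,p\}$ given in a parent ordering, let $U$ be a real symmetric positive definite $p\times p$ matrix and let $\alpha=(\alpha_1,\dots,\alpha_p)\in\mathbb R^p$. The kernel $$\exp\Big\{-\tfrac12\operatorname{tr}(LD^{-1}L^\top U)\Big\}\prod_{i=1}^p D_{ii}^{-\alpha_i/2},\qquad (D,L)\in\Theta_{\mathcal D},$$ is integrable with respect to $\prod_i dD_{ii}\prod_i\prod_{j\in\mathrm{pa}(i)}dL_{ji}$ if and only if $\alpha_i>pa_i+2$ for all $i$. In that case, if $(D,L)$ is distributed according to the normalized law (the probability density on $\Theta_{\mathcal D}$ proportional to the kernel), and $\ell_i:=L_{\prec i]}$, $\beta_i:=-\ell_i$, $a_i:=\frac{\alpha_i-pa_i}{2}-1$, then the pairs $(D_{ii},\beta_i)$, $i=1,\dots,p$, are mutually independent and $$D_{ii}\sim IG\Big(a_i,\tfrac12U_{ii\mid\prec i\succ}\Big),\qquad \beta_i\mid D_{ii}\sim \mathrm N_{pa_i}\Big(U_{\prec i\succ}^{-1}U_{\prec i]},\,D_{ii}U_{\prec i\succ}^{-1}\Big).$$ Equivalently, $\ell_i\mid D_{ii}\sim\mathrm N_{pa_i}\big(-U_{\prec i\succ}^{-1}U_{\prec i]},\,D_{ii}U_{\prec i\succ}^{-1}\big)$.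
   Context: Parent ordering: every directed edge $i\to j$ satisfies $i>j$. $\mathrm{pa}(i)$ is the set of parents of $i$ (vertices $j\neq i$ with $j\to i$), $pa_i=|\mathrm{pa}(i)|$. For a $p\times p$ matrix $A$: $A_{\prec i\succ}$ is the principal submatrix with rows and columns in $\mathrm{pa}(i)$; $A_{\prec i]}=(A_{ji})_{j\in\mathrm{pa}(i)}$ is a column vector; $A_{[i\succ}=(A_{ij})_{j\in\mathrm{pa}(i)}$ is a row vector; $A_{ii\mid\prec i\succ}=A_{ii}-A_{[i\succ}A_{\prec i\succ}^{-1}A_{\prec i]}$. If $\mathrm{pa}(i)=\emptyset$, determinants of $A_{\prec i\succ}$ equal one and the associated vectors and quadratic forms are absent (so $A_{ii\mid\prec i\succ}=A_{ii}$). $\mathcal L_{\mathcal D}$ is the set of real lower triangular $p\times p$ matrices $L$ with unit diagonal and $L_{ij}=0$ whenever $i\ne j$ and $i\notin\mathrm{pa}(j)$; $\Theta_{\mathcal D}$ is the set of pairs $(D,L)$ with $D$ a $p\times p$ diagonal matrix with strictly positive diagonal and $L\in\mathcal L_{\mathcal D}$. $IG(a,b)$ has density $b^a\Gamma(a)^{-1}x^{-a-1}e^{-b/x}$, $x>0$. $\mathrm N_d(m,C)$ is the $d$-dimensional normal law with mean $m$ and covariance $C$. *)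

(* Defs.v *)
From HB Require Import structures.
From mathcomp Require Export all_boot all_order all_algebra.
From mathcomp Require Export all_classical all_reals all_analysis.
From mathcomp Require Export measurable_realfun.

Set Implicit Arguments.
Unset Strict Implicit.
Unset Printing Implicit Defensive.

Import Order.TTheory GRing.Theory Num.Theory.
Import numFieldNormedType.Exports.

Local Open Scope classical_set_scope.
Local Open Scope ring_scope.

Definition matrix_display : measure_display -> measure_display.
Proof. exact. Qed.

Section measurable_matrix.
Context d (T : measurableType d) (m n : nat).

(* The product sigma-algebra on matrices: generated by the entries. *)
Definition matrix_measurable : set (set 'M[T]_(m, n)) :=
  <<s \bigcup_(ij in [set: 'I_m * 'I_n])
        preimage_set_system setT (fun M : 'M[T]_(m, n) => M ij.1 ij.2)
          measurable >>.

Let matrix_measurable0 : matrix_measurable set0.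
Proof. exact: sigma_algebra0. Qed.

Let matrix_measurableC A : matrix_measurable A -> matrix_measurable (~` A).
Proof. exact: sigma_algebraC. Qed.

Let matrix_measurable_bigcup (F : (set 'M[T]_(m, n))^nat) :
  (forall i, matrix_measurable (F i)) -> matrix_measurable (\bigcup_i F i).
Proof. exact: sigma_algebra_bigcup. Qed.

HB.instance Definition _ := @isMeasurable.Build (matrix_display d)
  'M[T]_(m, n) matrix_measurable matrix_measurable0 matrix_measurableC
  matrix_measurable_bigcup.

Lemma measurable_mx_entry (i : 'I_m) (j : 'I_n) :
  measurable_fun setT (fun M : 'M[T]_(m, n) => M i j).
Proof.
move=> _ Y mY; rewrite setTI; apply: sub_sigma_algebra.
by exists (i, j) => //; exists Y => //; rewrite setTI.
Qed.

Lemma measurable_fun_mxP d' (T' : measurableType d') (f : T' -> 'M[T]_(m, n)) :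
  (forall i j, measurable_fun setT (fun x => f x i j)) -> measurable_fun setT f.
Proof.
move=> mf; apply: (measurability
  (\bigcup_(ij in [set: 'I_m * 'I_n])
     preimage_set_system setT (fun M : 'M[T]_(m, n) => M ij.1 ij.2)
       measurable)) => //.
move=> _ [_ [[i j] _ [B mB <-]] <-].
rewrite setTI -comp_preimage.
exact: mf.
Qed.

End measurable_matrix.

(* The library only has this instance locally. *)
Section product_sigma_finite.
Context d1 d2 (T1 : measurableType d1) (T2 : measurableType d2) (R : realType).
Variable m1 : {sigma_finite_measure set T1 -> \bar R}.
Variable m2 : {sigma_finite_measure set T2 -> \bar R}.
Local Open Scope ereal_scope.

Lemma product_measure1_sigma_finite : sigma_finite setT (m1 \x m2).
Proof.
have /sigma_finiteP[F [TF ndF Foo]] := sigma_finiteT m1.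
have /sigma_finiteP[G [TG ndG Goo]] := sigma_finiteT m2.
exists (fun n => F n `*` G n).
  rewrite -setXTT TF TG predeqE => -[x y]; split.
    move=> [/= [n _ Fnx] [k _ Gky]]; exists (maxn n k) => //; split.
    - by move: x Fnx; exact/subsetPset/ndF/leq_maxl.
    - by move: y Gky; exact/subsetPset/ndG/leq_maxr.
  by move=> [n _ []/= ? ?]; split; exists n.
move=> k; have [? ?] := Foo k; have [? ?] := Goo k.
split; first exact: measurableX.
by rewrite product_measure1E// lte_mul_pinfty// ge0_fin_numE.
Qed.

HB.instance Definition _ := Measure_isSigmaFinite.Build _ _ _ (m1 \x m2)
  product_measure1_sigma_finite.

End product_sigma_finite.

Section lebesgue_cV.
Context (R : realType).
Local Open Scope ereal_scope.

(* Lebesgue measure on R^n, as the n-fold product of lebesgue_measure; see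
   lebesgue_cV_box. *)
Definition consV n (z : measurableTypeR R * 'cV[R]_n) : 'cV[R]_n.+1 :=
  \col_i (if unlift ord0 i is Some j then z.2 j ord0 else z.1).

Lemma measurable_consV n : measurable_fun setT (@consV n).
Proof.
apply: measurable_fun_mxP => i j; case E: (unlift ord0 i) => [k|].
  rewrite (_ : (fun z => _) = (fun x : 'cV[R]_n => x k ord0) \o snd).
    by apply: measurableT_comp; [exact: measurable_mx_entry|].
  by apply/funext => z /=; rewrite mxE E.
by rewrite (_ : (fun z => _) = fst) //; apply/funext => z /=; rewrite mxE E.
Qed.

HB.instance Definition _ n :=
  isMeasurableFun.Build _ _ _ _ (@consV n) (@measurable_consV n).

Lemma consV_inj n : injective (@consV n).
Proof.
move=> [a x] [b y] /matrixP xy; congr pair.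
  by have := xy ord0 ord0; rewrite !mxE unlift_none.
apply/matrixP => i j; rewrite (ord1 j).
by have := xy (lift ord0 i) ord0; rewrite !mxE liftK.
Qed.

Lemma consV_surj n (x : 'cV[R]_n.+1) :
  consV (x ord0 ord0, \col_i x (lift ord0 i) ord0) = x.
Proof.
apply/matrixP => i j; rewrite (ord1 j) mxE.
by case: unliftP => [k ->|->] //=; rewrite mxE.
Qed.

Section step.
Variables (n : nat) (mu : {sigma_finite_measure set 'cV[R]_n -> \bar R}).

Definition lebesgue_cV_step : set 'cV[R]_n.+1 -> \bar R :=
  pushforward (lebesgue_measure \x mu) (@consV n).

Let step0 : lebesgue_cV_step set0 = 0.
Proof. by rewrite /lebesgue_cV_step /pushforward preimage_set0 measure0. Qed.

Let step_ge0 A : 0 <= lebesgue_cV_step A.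
Proof. exact: measure_ge0. Qed.

Let step_sigma_additive : semi_sigma_additive lebesgue_cV_step.
Proof. exact: measure_semi_sigma_additive. Qed.

HB.instance Definition _ := isMeasure.Build _ _ _ lebesgue_cV_step
  step0 step_ge0 step_sigma_additive.

Let sigma_finite_step : sigma_finite setT lebesgue_cV_step.
Proof.
pose g (x : 'cV[R]_n.+1) : measurableTypeR R * 'cV[R]_n :=
  (x ord0 ord0, \col_i x (lift ord0 i) ord0).
have gK : cancel g (@consV n) by exact: consV_surj.
have consVK : cancel (@consV n) g by move=> z; apply: consV_inj; exact: gK.
have mg : measurable_fun setT g.
  apply/measurable_fun_pair; first exact: measurable_mx_entry.
  apply: measurable_fun_mxP => i j.
  rewrite (_ : (fun z => _) = (fun x : 'cV[R]_n.+1 => x (lift ord0 i) ord0)).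
    exact: measurable_mx_entry.
  by apply/funext => z /=; rewrite mxE.
have [F FT Foo] := product_measure1_sigma_finite (@lebesgue_measure R) mu.
exists (fun k => g @^-1` F k).
  by rewrite -preimage_bigcup -FT preimage_setT.
move=> k; have [mF Fk] := Foo k; split.
  by rewrite -[X in measurable X]setTI; exact: mg.
rewrite /lebesgue_cV_step /pushforward (_ : _ @^-1` _ = F k)//.
by apply/seteqP; split => z /=; rewrite consVK.
Qed.

HB.instance Definition _ :=
  Measure_isSigmaFinite.Build _ _ _ lebesgue_cV_step sigma_finite_step.

End step.

Fixpoint lebesgue_cV n : {sigma_finite_measure set 'cV[R]_n -> \bar R} :=
  match n with
  | 0 => dirac (0%R : 'cV[R]_0)
  | n'.+1 => lebesgue_cV_step (lebesgue_cV n')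
  end.

Lemma lebesgue_cV_box n (A : 'I_n -> set R) : (forall i, measurable (A i)) ->
  lebesgue_cV n [set x | forall i, A i (x i ord0)] =
  \prod_(i < n) lebesgue_measure (A i).
Proof.
elim: n A => [|n IH] A mA.
  by rewrite big_ord0 /= diracE mem_set// => -[].
pose B := [set x : 'cV[R]_n | forall i, A (lift ord0 i) (x i ord0)].
have mB : measurable B.
  have -> : B = \bigcap_(i in [set: 'I_n])
      ((fun x : 'cV[R]_n => x i ord0) @^-1` A (lift ord0 i)).
    by apply/seteqP; split => [x Bx i _|x Bx i]; [exact: Bx|exact: Bx i I].
  apply: fin_bigcap_measurable => // i _.
  by rewrite -[X in measurable X]setTI; apply: measurable_mx_entry.
rewrite big_ord_recl -(IH (fun i => A (lift ord0 i)))//.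
rewrite /= /lebesgue_cV_step /pushforward -/B.
rewrite -product_measure1E//; last exact: mA.
congr (_ _).
apply/seteqP; split => [[a x] /= Ax|[a x] [/= Aa Ax] i].
  split; first by have := Ax ord0; rewrite mxE unlift_none.
  by move=> i /=; have := Ax (lift ord0 i); rewrite mxE liftK.
by rewrite mxE; case: unliftP => [j ->|->].
Qed.

End lebesgue_cV.

Section distributions.
Context (R : realType).

Definition Gamma (a : R) : R :=
  \int[lebesgue_measure]_(x in `]0, +oo[) (x `^ (a - 1) * expR (- x)).

Definition inverse_gamma_pdf (a b x : R) : R :=
  if 0 < x then b `^ a / Gamma a * x `^ (- a - 1) * expR (- (b / x)) else 0.

Definition inverse_gamma (a b : R) (A : set R) : \bar R :=
  (\int[lebesgue_measure]_(x in A) (inverse_gamma_pdf a b x)%:E)%E.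

(* The normal law N_n(m, C) is given by its Lebesgue density, so C is meant to
   be positive definite; for n = 0 this is the Dirac mass on 'cV_0. *)
Definition mvnormal_pdf n (m : 'cV[R]_n) (C : 'M[R]_n) (x : 'cV[R]_n) : R :=
  (Num.sqrt ((2 * pi) ^+ n * \det C))^-1 *
  expR (- ((x - m)^T *m invmx C *m (x - m)) ord0 ord0 / 2).

Definition mvnormal n (m : 'cV[R]_n) (C : 'M[R]_n) (A : set 'cV[R]_n) :
    \bar R :=
  (\int[lebesgue_cV R n]_(x in A) (mvnormal_pdf m C x)%:E)%E.

End distributions.

Section probability_notions.
Local Open Scope ereal_scope.
Context d (Omega : measurableType d) (R : realType) (P : probability Omega R).

Definition has_law d' (T : measurableType d') (X : Omega -> T)
    (mu : set T -> \bar R) : Prop :=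
  forall A, measurable A -> P (X @^-1` A) = mu A.

(* K x is the law of Y given X = x: K is a regular conditional distribution
   of Y given X. *)
Definition has_cond_law d1 (T1 : measurableType d1) d2 (T2 : measurableType d2)
    (X : Omega -> T1) (Y : Omega -> T2) (K : T1 -> set T2 -> \bar R) : Prop :=
  (forall B, measurable B -> measurable_fun setT (K^~ B)) /\
  (forall A B, measurable A -> measurable B ->
     P (X @^-1` A `&` Y @^-1` B) = \int[pushforward P X]_(x in A) K x B).

Definition mutually_independent (I : finType) (dT : I -> measure_display)
    (T : forall i, measurableType (dT i)) (X : forall i, Omega -> T i) : Prop :=
  forall (J : {set I}) (A : forall i, set (T i)),
    (forall i, i \in J -> measurable (A i)) ->
    P (\bigcap_(i in [set` J]) (X i @^-1` A i)) =
    \prod_(i in J) P (X i @^-1` A i).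

End probability_notions.

Definition posdefmx (R : realType) n (A : 'M[R]_n) : Prop :=
  A^T = A /\
  (forall x : 'cV[R]_n, x != 0 -> 0 < (x^T *m A *m x) ord0 ord0).

(* A directed graph on 'I_p is a relation e, with e i j meaning i -> j.  A
   parent ordering makes every edge decreasing, hence the graph acyclic. *)
Definition parent_ordered p (e : rel 'I_p) : Prop :=
  forall i j : 'I_p, e i j -> (j < i)%N.

Section dag.
Context (R : realType) (p : nat) (e : rel 'I_p).
Implicit Types (A L : 'M[R]_p) (i j : 'I_p).

Definition pa i : {set 'I_p} := [set j | (j != i) && e j i].

(* Vectors and matrices indexed by pa i are indexed by 'I_#|pa i| through the
   enumeration enum_val of pa i. *)
Definition pa_mx A i : 'M[R]_#|pa i| :=
  \matrix_(k, l) A (enum_val k) (enum_val l).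

Definition pa_col A i : 'cV[R]_#|pa i| := \col_k A (enum_val k) i.

Definition pa_row A i : 'rV[R]_#|pa i| := \row_k A i (enum_val k).

Definition pa_schur A i : R :=
  A i i - (pa_row A i *m invmx (pa_mx A i) *m pa_col A i) ord0 ord0.

Definition LD : set 'M[R]_p :=
  [set L | [/\ forall i j, (i < j)%N -> L i j = 0,
               forall i, L i i = 1 &
               forall i j, i != j -> i \notin pa j -> L i j = 0]].

Definition ThetaD : set ('M[R]_p * 'M[R]_p) :=
  [set DL | [/\ is_diag_mx DL.1, forall i, 0 < DL.1 i i & LD DL.2]].

(* The free coordinates of L: the entries L j i with j \in pa i. *)
Definition edge_entries : {set 'I_p * 'I_p} := [set ji | ji.1 \in pa ji.2].

Definition chol_coord (z : 'cV[R]_p * 'cV[R]_#|edge_entries|) :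
    'M[R]_p * 'M[R]_p :=
  (diag_mx z.1^T,
   1%:M + \sum_(k < #|edge_entries|)
      z.2 k ord0 *: delta_mx (enum_val k).1 (enum_val k).2).

Lemma measurable_chol_coord : measurable_fun setT chol_coord.
Proof.
have m1 i : measurable_fun setT
    (fun z : 'cV[R]_p * 'cV[R]_#|edge_entries| => z.1 i ord0).
  apply: (measurableT_comp (f := fun x : 'cV[R]_p => x i ord0)) => //.
  exact: measurable_mx_entry.
have m2 k : measurable_fun setT
    (fun z : 'cV[R]_p * 'cV[R]_#|edge_entries| => z.2 k ord0).
  apply: (measurableT_comp
    (f := fun x : 'cV[R]_#|edge_entries| => x k ord0)) => //.
  exact: measurable_mx_entry.
apply/measurable_fun_pair; apply: measurable_fun_mxP => i j.
  have [<-|ij] := eqVneq i j.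
    rewrite (_ : (fun z => _) = (fun z : 'cV[R]_p * 'cV[R]_#|edge_entries| =>
        z.1 i ord0)); first exact: m1.
    by apply/funext => z; rewrite !mxE eqxx mulr1n.
  rewrite (_ : (fun z => _) = cst 0); first exact: measurable_cst.
  by apply/funext => z; rewrite !mxE (negbTE ij) mulr0n.
rewrite (_ : (fun z => _) = (fun z : 'cV[R]_p * 'cV[R]_#|edge_entries| =>
    (i == j)%:R + \sum_(k < #|edge_entries|)
      z.2 k ord0 * delta_mx (enum_val k).1 (enum_val k).2 i j)).
  apply: measurable_funD; first exact: measurable_cst.
  apply: measurable_sum => k.
  by apply: measurable_funM; [exact: m2|exact: measurable_cst].
apply/funext => z; rewrite !mxE summxE; congr (_ + _).
by apply: eq_bigr => k _; rewrite mxE.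
Qed.

HB.instance Definition _ :=
  isMeasurableFun.Build _ _ _ _ chol_coord measurable_chol_coord.

(* The measure prod_i dD_ii prod_i prod_(j in pa i) dL_ji, as the image of
   Lebesgue measure on the coordinate space. *)
Definition chol_measure : set ('M[R]_p * 'M[R]_p) -> \bar R :=
  pushforward (lebesgue_cV R p \x lebesgue_cV R #|edge_entries|)%E chol_coord.

End dag.

Section chol_measure_instance.
Context (R : realType) (p : nat) (e : rel 'I_p).

Local Notation chol_measure := (@chol_measure R p e).

Let chol_measure0 : chol_measure set0 = 0%E.
Proof. by rewrite /chol_measure /pushforward preimage_set0 measure0. Qed.

Let chol_measure_ge0 (B : set ('M[R]_p * 'M[R]_p)) : (0 <= chol_measure B)%E.
Proof. exact: measure_ge0. Qed.

Let chol_measure_sigma_additive : semi_sigma_additive chol_measure.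
Proof. exact: measure_semi_sigma_additive. Qed.

HB.instance Definition _ := isMeasure.Build _ _ _ chol_measure
  chol_measure0 chol_measure_ge0 chol_measure_sigma_additive.

End chol_measure_instance.

Section chol_law.
Context (R : realType) (p : nat) (e : rel 'I_p).
Implicit Types (U : 'M[R]_p) (alpha : 'I_p -> R).

Local Notation ThetaD := (@ThetaD R p e).
Local Notation chol_measure := (@chol_measure R p e).

Definition chol_kernel U alpha (DL : 'M[R]_p * 'M[R]_p) : R :=
  let: (D, L) := DL in
  expR (- (\tr (L *m invmx D *m L^T *m U) / 2)) *
  \prod_i (D i i `^ (- (alpha i / 2))).

Definition chol_const U alpha : R :=
  \int[chol_measure]_(DL in ThetaD) chol_kernel U alpha DL.

(* The law with density proportional to the kernel on ThetaD. *)
Definition chol_law U alpha (A : set ('M[R]_p * 'M[R]_p)) : \bar R :=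
  (\int[chol_measure]_(DL in A `&` ThetaD)
     (chol_kernel U alpha DL / chol_const U alpha)%:E)%E.

End chol_law.

(* Main.v *)
Require Import Defs.
From mathcomp Require Import all_boot all_order all_algebra.
From mathcomp Require Import all_classical all_reals all_analysis.
From mathcomp Require Import measurable_realfun.
From mathcomp Require Import ring.

Set Implicit Arguments.
Unset Strict Implicit.
Unset Printing Implicit Defensive.

Import Order.TTheory GRing.Theory Num.Theory.
Import numFieldNormedType.Exports.

Local Open Scope classical_set_scope.
Local Open Scope ring_scope.

(** Why the theorem holds.  Column i of L is supported on i and its parents, and
    tr (L D^-1 L^T U) is the sum over i of U[L_i] / D_ii, where U[.] is the
    quadratic form of U and L_i is column i.  Completing the square
    (qform_complete_square) gives

      U[L_i] = s_i + (l_i + m_i)^T U_i (l_i + m_i),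

    where U_i is the submatrix of U on the parents of i, u_i the part of column i
    on these rows, m_i = U_i^-1 u_i the vector of regression coefficients, and s_i
    the Schur complement of U_i.  So the
    kernel is a product over i of functions of the blocks (D_ii, l_i) alone
    (chol_kernelE).  In each factor the dependence on l_i is an unnormalized
    normal density with mean - m_i and covariance D_ii U_i^-1, and its normalizing
    constant is proportional to D_ii ^ (pa_i / 2); what remains is
    D_ii ^ (- a_i - 1) exp (- s_i / (2 D_ii)), an unnormalized inverse gamma
    density with a_i = (alpha_i - pa_i) / 2 - 1 (block_kernelE).

    The reference measure is also a product over the blocks, because all the
    coordinates can be integrated in any order (ge0_integral_chol_coord).  Hence
    the integral of the kernel over a product of events is the product of the
    block integrals (integral_chol_kernel_cyl).  Independence of the blocks and
    the marginal and conditional laws are read off from this formula.  The total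
    mass is finite exactly when each inverse gamma integral is, that is when each
    a_i is positive (chol_kernel_integrable).

    Three integrals carry the computation: the Gaussian integral on
    column vectors, by induction on the dimension through Schur complements
    (integral_gauss); the divergence or convergence of the inverse gamma integral,
    by comparison with 1 / x and with (1 + x) ^ (- a - 1) (ig_integral_pinfty,
    ig_integral_lty); and its value Gamma(a) / b ^ a, by the substitution
    x = b / y (ig_integral_subst). *)

(** * Lebesgue measure on column vectors *)

Section lebesgue_cV_integral.
Context (R : realType).
Local Open Scope ereal_scope.

Lemma consV0 n (z : R * 'cV[R]_n) : consV z ord0 ord0 = z.1.
Proof. by rewrite mxE unlift_none. Qed.

Lemma consVS n (z : R * 'cV[R]_n) i : consV z (lift ord0 i) ord0 = z.2 i ord0.
Proof. by rewrite mxE liftK. Qed.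

Lemma ge0_integral_cVS n (f : 'cV[R]_n.+1 -> \bar R) :
  measurable_fun setT f -> (forall x, 0 <= f x) ->
  \int[lebesgue_cV R n.+1]_x f x =
  \int[lebesgue_measure]_t \int[lebesgue_cV R n]_z f (consV (t, z)).
Proof.
move=> mf f0.
transitivity (\int[pushforward (lebesgue_measure \x lebesgue_cV R n)%E
    (@consV R n)]_x f x).
  exact: (@eq_measure_integral _ _ _ _ _ (lebesgue_cV R n.+1)).
rewrite (ge0_integral_pushforward (@measurable_consV R n))//.
rewrite preimage_setT fubini_tonelli1// => [|x]; last exact: f0.
exact: measurableT_comp.
Qed.

Lemma ge0_integral_cVS_swap n (f : 'cV[R]_n.+1 -> \bar R) :
  measurable_fun setT f -> (forall x, 0 <= f x) ->
  \int[lebesgue_cV R n.+1]_x f x =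
  \int[lebesgue_cV R n]_z \int[lebesgue_measure]_t f (consV (t, z)).
Proof.
move=> mf f0; rewrite ge0_integral_cVS//.
apply: (@fubini_tonelli _ _ (measurableTypeR R) _ _ lebesgue_measure
  (lebesgue_cV R n) (f \o @consV R n)) => [|x]; last exact: f0.
exact: measurableT_comp.
Qed.

Lemma ge0_integral_cV0 (f : 'cV[R]_0 -> \bar R) :
  measurable_fun setT f -> \int[lebesgue_cV R 0]_x f x = f 0%R.
Proof. by move=> mf; rewrite /= integral_dirac// diracT mul1e. Qed.

Lemma ge0_integral_opp (f : R -> \bar R) :
  measurable_fun setT f -> (forall x, 0 <= f x) ->
  \int[lebesgue_measure]_x f (- x)%R = \int[lebesgue_measure]_x f x.
Proof.
move=> mf f0.
transitivity (\int[pushforward (@lebesgue_measure R)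
    (-%R : _ -> measurableTypeR R)]_x f x).
  exact/esym/(@ge0_integral_pushforward _ _ (measurableTypeR R)
    (measurableTypeR R) R -%R (@oppr_measurable R setT) lebesgue_measure setT f
    measurableT mf (fun x _ => f0 x)).
by apply: eq_measure_integral => A mA _; exact: lebesgue_measureN.
Qed.

(** Reflection invariance, which carries the law of a vector to the law of its
    opposite. *)
Lemma ge0_integral_cV_opp n (f : 'cV[R]_n -> \bar R) :
  measurable_fun setT f -> (forall x, 0 <= f x) ->
  \int[lebesgue_cV R n]_x f (- x)%R = \int[lebesgue_cV R n]_x f x.
Proof.
have mN m : measurable_fun setT (fun x : 'cV[R]_m => - x)%R.
  apply: measurable_fun_mxP => i j.
  rewrite (_ : (fun x => _) = (fun x : 'cV[R]_m => - x i j)%R); last first.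
    by apply/funext => x; rewrite mxE.
  by apply: measurable_funN; exact: measurable_mx_entry.
elim: n f => [|n IH] f mf f0.
  rewrite !ge0_integral_cV0 ?oppr0//.
  by apply: measurableT_comp mf _; exact: mN.
have mc : measurable_fun setT (f \o @consV R n).
  exact: measurableT_comp.
rewrite !ge0_integral_cVS//; last by apply: measurableT_comp mf _; exact: mN.
rewrite -[RHS]ge0_integral_opp; last 2 first.
  exact: (@measurable_fun_fubini_tonelli_F _ _ (measurableTypeR R) _ _
            (lebesgue_cV R n) _ mc (fun x => f0 _)).
  by move=> x; exact: integral_ge0.
apply: eq_integral => t _ /=.
rewrite -[RHS]IH//; last first.
  exact: (measurable_fun_pair2 (T1 := measurableTypeR R) (- t)%R mc).
apply: eq_integral => z _; congr f; apply/matrixP => i j.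
by rewrite !mxE; case: unliftP => [k _|_] /=; rewrite ?mxE.
Qed.

End lebesgue_cV_integral.


(** * Gaussian integrals *)

Section quadratic_forms.
Context (R : realType).
Local Open Scope ring_scope.

Definition qform n (A : 'M[R]_n) (x : 'cV[R]_n) : R :=
  (x^T *m A *m x) ord0 ord0.

Lemma qformE n (A : 'M[R]_n) x :
  qform A x = \sum_i \sum_j x i ord0 * A i j * x j ord0.
Proof.
rewrite /qform mxE exchange_big; apply: eq_bigr => j _ /=.
by rewrite mxE mulr_suml; apply: eq_bigr => i _; rewrite mxE.
Qed.

Lemma measurable_qform n (A : 'M[R]_n) m d (T : measurableType d)
    (f : T -> 'cV[R]_n) : measurable_fun setT f ->
  measurable_fun setT (fun x => qform A (f x - m)).
Proof.
move=> mf.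
have me i : measurable_fun setT (fun x => (f x - m) i ord0).
  rewrite (_ : (fun x => _) = (fun x => f x i ord0 - m i ord0)); last first.
    by apply/funext => x; rewrite !mxE.
  apply: measurable_funB; last exact: measurable_cst.
  apply: (measurableT_comp (f := fun y : 'cV[R]_n => y i ord0)) => //.
  exact: measurable_mx_entry.
rewrite (_ : (fun x => _) = (fun x => \sum_i \sum_j
    (f x - m) i ord0 * A i j * (f x - m) j ord0)); last first.
  by apply/funext => x; rewrite qformE.
apply: measurable_sum => i; apply: measurable_sum => j.
by apply: measurable_funM => //; apply: measurable_funM.
Qed.

(** The Schur complement of the corner entry, which is what remains of A when
    the first coordinate of a Gaussian integral has been integrated out. *)
Definition schur0 n (A : 'M[R]_n.+1) : 'M[R]_n :=
  \matrix_(i, j) (A (lift ord0 i) (lift ord0 j) -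
    A (lift ord0 i) ord0 * A (lift ord0 j) ord0 / A ord0 ord0).

(** Completing the square in the first coordinate. *)
Lemma qform_consV n (A : 'M[R]_n.+1) t (z : 'cV[R]_n) :
  A^T = A -> A ord0 ord0 != 0 ->
  qform A (consV (t, z)) =
  A ord0 ord0 *
    (t + (\sum_i A (lift ord0 i) ord0 * z i ord0) / A ord0 ord0) ^+ 2 +
  qform (schur0 A) z.
Proof.
move=> As a0; set a := A ord0 ord0; set b := \sum_i _.
have Asym i j : A i j = A j i by rewrite -{1}As mxE.
pose B := \sum_i \sum_j
  z i ord0 * A (lift ord0 i) (lift ord0 j) * z j ord0.
have -> : qform (schur0 A) z = B - b ^+ 2 / a.
  rewrite qformE /B expr2 {1}/b !mulr_suml -sumrB.
  apply: eq_bigr => i _; rewrite /b mulr_sumr mulr_suml -sumrB.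
  by apply: eq_bigr => j _; rewrite mxE -/a; field.
have -> : qform A (consV (t, z)) = t * a * t + t * b + (b * t + B).
  rewrite qformE big_ord_recl; congr (_ + _).
    rewrite big_ord_recl consV0 /=; congr (_ + _).
    rewrite /b mulr_sumr; apply: eq_bigr => i _.
    by rewrite consVS /= Asym; ring.
  rewrite /b /B mulr_suml -big_split /=; apply: eq_bigr => i _.
  rewrite big_ord_recl consV0 consVS /=; congr (_ + _); first by ring.
  by apply: eq_bigr => j _; rewrite consVS.
by field.
Qed.

Lemma posdef_corner n (A : 'M[R]_n.+1) : posdefmx A -> 0 < A ord0 ord0.
Proof.
move=> [As A0].
have x0 : consV (1, 0 : 'cV[R]_n) != 0.
  apply/eqP => /matrixP/(_ ord0 ord0); rewrite consV0 mxE /=.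
  by move/eqP; rewrite oner_eq0.
have := A0 _ x0; rewrite -/(qform _ _) qformE big_ord_recl big_ord_recl.
rewrite big1 => [|i _]; last by rewrite consV0 consVS /= mxE mulr0.
rewrite big1 => [|i _]; last first.
  by rewrite big1// => j _; rewrite consVS /= mxE !mul0r.
by rewrite consV0 /= mul1r mulr1 !addr0.
Qed.

Lemma posdef_schur0 n (A : 'M[R]_n.+1) : posdefmx A -> posdefmx (schur0 A).
Proof.
move=> pA; have a0 := posdef_corner pA; have [As A0] := pA.
split=> [|z z0].
  by apply/matrixP => i j; rewrite !mxE -{1}As mxE [X in _ - X / _]mulrC.
(* This first coordinate minimizes the quadratic form for given z. *)
pose t := - ((\sum_i A (lift ord0 i) ord0 * z i ord0) / A ord0 ord0).
have x0 : consV (t, z) != 0.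
  apply: contra_neq z0 => /matrixP x0; apply/matrixP => i j.
  by have := x0 (lift ord0 i) ord0; rewrite consVS !mxE (ord1 j).
have := A0 _ x0; rewrite -/(qform _ _) qform_consV ?gt_eqF//.
by rewrite addNr expr0n mulr0 add0r.
Qed.

(** Eliminating column 0 by a unipotent matrix makes A block triangular. *)
Lemma det_schur0 n (A : 'M[R]_n.+1) : A^T = A -> A ord0 ord0 != 0 ->
  \det A = A ord0 ord0 * \det (schur0 A).
Proof.
move=> As a0; have Asym i j : A i j = A j i by rewrite -{1}As mxE.
pose E : 'M[R]_(1 + n) := block_mx 1%:M 0
  (\col_i (- A (lift ord0 i) ord0 / A ord0 ord0)) 1%:M.
have EA : @mulmx _ (1 + n) (1 + n) (1 + n) E A =
    block_mx (A ord0 ord0)%:M (\row_j A ord0 (lift ord0 j)) 0 (schur0 A).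
  have ul : ulsubmx (A : 'M[R]_(1 + n)) = (A ord0 ord0)%:M.
    apply/matrixP => i j; rewrite !ord1 !mxE eqxx mulr1n.
    by congr (A _ _); exact: val_inj.
  have ur : ursubmx (A : 'M[R]_(1 + n)) = \row_j A ord0 (lift ord0 j).
    apply/matrixP => i j; rewrite !ord1 !mxE rshift1.
    by congr (A _ _); exact: val_inj.
  have dl : dlsubmx (A : 'M[R]_(1 + n)) = \col_i A (lift ord0 i) ord0.
    apply/matrixP => i j; rewrite !ord1 !mxE rshift1.
    by congr (A _ _); exact: val_inj.
  rewrite -[in LHS](@submxK _ 1 n 1 n A) /E mulmx_block.
  rewrite !mul1mx !mul0mx !addr0 ul ur dl; congr block_mx.
    by apply/matrixP => i j; rewrite !mxE big_ord1 !mxE (ord1 j) eqxx mulr1n;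
      field.
  apply/matrixP => i j; rewrite !mxE big_ord1 !mxE !rshift1.
  by rewrite (Asym ord0); field.
have := congr1 determinant EA; rewrite det_mulmx det_lblock det_ublock.
by rewrite !det1 !mul1r det_scalar1.
Qed.

Lemma posdef_det_gt0 n (A : 'M[R]_n) : posdefmx A -> 0 < \det A.
Proof.
elim: n A => [|n IH] A pA; first by rewrite det_mx00.
have a0 := posdef_corner pA.
rewrite det_schur0 ?gt_eqF//; last by case: pA.
by rewrite mulr_gt0// IH//; exact: posdef_schur0.
Qed.

End quadratic_forms.

Section gaussian_integral.
Context (R : realType).
Local Open Scope ereal_scope.

Lemma integral_gauss1 (c m : R) : (0 < c)%R ->
  \int[lebesgue_measure]_x (expR (- (c * (x - m) ^+ 2 / 2)))%:E =
  (Num.sqrt (2 * pi / c))%:E.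
Proof.
move=> c0; pose s := Num.sqrt c^-1.
have s2 : (s ^+ 2 = c^-1)%R by rewrite sqr_sqrtr// invr_ge0 ltW.
have s0 : s != 0%R by rewrite gt_eqF// sqrtr_gt0 invr_gt0.
have := integral_normal_pdf m s; rewrite normal_pdfE//.
under eq_integral do rewrite EFinM.
rewrite ge0_integralZl_EFin//=; last 3 first.
- by move=> x _; rewrite lee_fin normal_fun_ge0.
- by apply/measurable_EFinP; exact: measurable_normal_fun.
- exact: normal_peak_ge0.
have -> : \int[lebesgue_measure]_x (normal_fun m s x)%:E =
    \int[lebesgue_measure]_x (expR (- (c * (x - m) ^+ 2 / 2)))%:E.
  apply: eq_integral => x _; rewrite /normal_fun s2; congr (expR _)%:E.
  by field; rewrite gt_eqF.
rewrite /normal_peak s2.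
have -> : (c^-1 * pi *+ 2 = 2 * pi / c :> R)%R by rewrite mulr2n; ring.
set q := Num.sqrt _; have q0 : (0 < q)%R.
  by rewrite sqrtr_gt0 divr_gt0// mulr_gt0// pi_gt0.
move=> /(congr1 (mule q%:E)); rewrite muleA -EFinM divff ?gt_eqF// mul1e.
by rewrite mule1.
Qed.

(** Induction on the dimension: the first coordinate contributes a
    one-dimensional Gaussian integral whose centre depends on the other
    coordinates but whose value does not, and the other coordinates keep the
    Schur complement as their quadratic form. *)
Lemma integral_gauss n (A : 'M[R]_n) (m : 'cV[R]_n) : posdefmx A ->
  \int[lebesgue_cV R n]_x (expR (- (qform A (x - m)%R / 2)))%:E =
  (Num.sqrt ((2 * pi) ^+ n / \det A))%:E.
Proof.
have mq k (B : 'M[R]_k) u : measurable_fun setT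
    (fun x : 'cV[R]_k => (expR (- (qform B (x - u)%R / 2)))%:E).
  apply/measurable_EFinP; apply: measurableT_comp => //.
  apply: measurable_funN; apply: measurable_funM => //.
  exact: measurable_qform (@measurable_id _ _ _).
elim: n A m => [|n IH] A m pA.
  rewrite ge0_integral_cV0// det_mx00 expr0 divr1 sqrtr1 /qform.
  by rewrite mxE big_ord0 mul0r oppr0 expR0.
have a0 := posdef_corner pA; have pS := posdef_schur0 pA.
have As : A^T = A by case: pA.
rewrite ge0_integral_cVS_swap//.
set a := A ord0 ord0 in a0 *; pose m' : 'cV[R]_n := (\col_i m (lift ord0 i) ord0)%R.
pose c z : R := (m ord0 ord0 -
  (\sum_i A (lift ord0 i) ord0 * (z - m') i ord0) / a)%R.
transitivity (\int[lebesgue_cV R n]_z ((Num.sqrt (2 * pi / a))%:E *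
    (expR (- (qform (schur0 A) (z - m')%R / 2)))%:E)).
  apply: eq_integral => z _; rewrite -(integral_gauss1 (c z))//.
  rewrite muleC -ge0_integralZl_EFin//; last first.
    apply/measurable_EFinP; apply: measurableT_comp => //.
    apply: measurable_funN; apply: measurable_funM => //.
    by apply: measurable_funM => //; apply: measurable_funX; exact: measurable_funB.
  apply: eq_integral => t _; rewrite -EFinM -expRD; congr (expR _)%:E.
  have -> : (consV (t, z) - m = consV (t - m ord0 ord0, z - m'))%R.
    apply/matrixP => i j; rewrite (ord1 j) !mxE.
    by case: unliftP => [k ->|->] /=; rewrite ?mxE.
  rewrite qform_consV ?gt_eqF// -/a /c.
  set S := (\sum_i _)%R; field.
  by rewrite gt_eqF.
rewrite ge0_integralZl_EFin//; last exact: mq.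
rewrite IH// -EFinM -sqrtrM; last by rewrite divr_ge0 ?mulr_ge0 ?pi_ge0// ltW.
rewrite (@det_schur0 _ _ A) ?gt_eqF// -/a exprS; congr (Num.sqrt _)%:E.
by field; rewrite !gt_eqF// posdef_det_gt0.
Qed.

End gaussian_integral.

(** * Integrating matrix entries one at a time *)

Section entrywise_integration.
Context (R : realType) (m n : nat).
Implicit Types (X : 'M[R]_(m, n)) (F G : 'M[R]_(m, n) -> \bar R).
Implicit Types (k l : 'I_m * 'I_n) (s : seq ('I_m * 'I_n)).
Local Open Scope ereal_scope.

Definition set_entry X k (t : R) : 'M[R]_(m, n) :=
  (\matrix_(i, j) (if (i, j) == k then t else X i j))%R.

Lemma set_entryC X k l t u : k != l ->
  set_entry (set_entry X k t) l u = set_entry (set_entry X l u) k t.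
Proof.
move=> kl; apply/matrixP => i j; rewrite !mxE.
by case: (eqVneq (i, j) k) => [->|_]; rewrite ?(negbTE kl).
Qed.

Lemma set_entry_id X k t u : set_entry (set_entry X k t) k u = set_entry X k u.
Proof. by apply/matrixP => i j; rewrite !mxE; case: (_ == _). Qed.

Lemma measurable_set_entry k d (T : measurableType d)
    (f : T -> 'M[R]_(m, n)) (g : T -> R) :
  measurable_fun setT f -> measurable_fun setT g ->
  measurable_fun setT (fun x => set_entry (f x) k (g x)).
Proof.
move=> mf mg; apply: measurable_fun_mxP => i j.
have [<-|ijk] := eqVneq (i, j) k.
  rewrite (_ : (fun x => _) = g)//.
  by apply/funext => x; rewrite mxE eqxx.
rewrite (_ : (fun x => _) = (fun x => f x i j)); last first.
  by apply/funext => x; rewrite mxE (negbTE ijk).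
apply: (measurableT_comp (f := fun X : 'M[R]_(m, n) => X i j)) => //.
exact: measurable_mx_entry.
Qed.

(** Integration over a single entry turns a function of the matrix into a
    function of the matrix again.  So integrations over different entries
    compose and commute, and lists of entries can be reordered and split with no
    change of the ambient space. *)
Definition int_entry k F : 'M[R]_(m, n) -> \bar R :=
  fun X => \int[lebesgue_measure]_t F (set_entry X k t).

Definition int_entries s F := foldr int_entry F s.

Definition ge0_measurable F := measurable_fun setT F /\ forall X, 0 <= F X.

Definition free_of k F := forall X t, F (set_entry X k t) = F X.

Lemma measurable_entry_section k F X : measurable_fun setT F ->
  measurable_fun setT (fun t : R => F (set_entry X k t)).
Proof.
move=> mF; apply: measurableT_comp mF _.
by apply: measurable_set_entry; [exact: measurable_cst|exact: measurable_id].
Qed.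

Lemma ge0_measurable_int_entry k F :
  ge0_measurable F -> ge0_measurable (int_entry k F).
Proof.
move=> [mF F0]; split=> [|X]; last exact: integral_ge0.
apply: (@measurable_fun_fubini_tonelli_F _ _ _ (measurableTypeR R) R
  lebesgue_measure (fun z => F (set_entry z.1 k z.2))) => //.
apply: measurableT_comp mF _; apply: measurable_set_entry.
  exact: measurable_fst.
exact: measurable_snd.
Qed.

Lemma ge0_measurable_int_entries s F :
  ge0_measurable F -> ge0_measurable (int_entries s F).
Proof. by move=> F0; elim: s => //= k s; exact: ge0_measurable_int_entry. Qed.

Lemma int_entryC k l F : ge0_measurable F ->
  int_entry k (int_entry l F) = int_entry l (int_entry k F).
Proof.
move=> [mF F0]; have [->//|kl] := eqVneq k l.
apply/funext => X; rewrite /int_entry.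
under [RHS]eq_integral do under eq_integral do rewrite set_entryC 1?eq_sym//.
apply: (@fubini_tonelli _ _ (measurableTypeR R) (measurableTypeR R) R
  lebesgue_measure lebesgue_measure
  (fun z => F (set_entry (set_entry X k z.1) l z.2))) => //.
apply: measurableT_comp mF _; apply: measurable_set_entry; last first.
  exact: measurable_snd.
apply: measurable_set_entry; first exact: measurable_cst.
exact: measurable_fst.
Qed.

Lemma int_entriesC s s' F : ge0_measurable F ->
  int_entries s (int_entries s' F) = int_entries s' (int_entries s F).
Proof.
move=> F0; elim: s => //= k s ->; elim: s' => //= l s' <-.
by rewrite int_entryC//; exact/ge0_measurable_int_entries/ge0_measurable_int_entries.
Qed.

Lemma int_entries_perm s s' F : ge0_measurable F -> perm_eq s s' ->
  int_entries s F = int_entries s' F.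
Proof.
move=> F0; move: s s'.
suff H s s' : perm_eq s s' -> int_entries s F = int_entries s F ->
    int_entries s F = int_entries s' F by move=> s s' /H; exact.
apply: (catCA_perm_ind (P := fun u => int_entries s F = int_entries u F)).
move=> s1 s2 s3 ->; rewrite /int_entries !foldr_cat.
by rewrite -/(int_entries _ _) int_entriesC//; exact: ge0_measurable_int_entries.
Qed.

Lemma int_entry_free k l F : free_of k F -> free_of k (int_entry l F).
Proof.
move=> kF X t; apply: eq_integral => u _.
have [<-|kl] := eqVneq k l; first by rewrite set_entry_id.
by rewrite set_entryC// kF.
Qed.

Lemma int_entries_free k s F : free_of k F -> free_of k (int_entries s F).
Proof. by move=> kF; elim: s => //= l s; exact: int_entry_free. Qed.

Lemma int_entriesZl s F G : ge0_measurable F -> ge0_measurable G ->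
  (forall k, k \in s -> free_of k G) ->
  int_entries s (G \* F) = G \* int_entries s F.
Proof.
move=> F0 G0; elim: s => //= k s IH sG.
rewrite IH => [|l ls]; last by apply: sG; rewrite inE ls orbT.
apply/funext => X; rewrite /int_entry /=.
under eq_integral do rewrite sG ?inE ?eqxx//.
have [mF F0'] := ge0_measurable_int_entries s F0.
rewrite ge0_integralZl//; last by case: G0.
exact: measurable_entry_section.
Qed.

(** By induction on the list of groups of entries: while one group is being
    integrated, the functions attached to the other groups are constants, and
    they stay so after their own entries have been integrated out. *)
Lemma int_entries_prod (J : eqType) (r : seq J) (s : J -> seq ('I_m * 'I_n))
    (f : J -> 'M[R]_(m, n) -> \bar R) :
  uniq r -> (forall j, ge0_measurable (f j)) ->
  (forall i j k, i != j -> k \in s j -> free_of k (f i)) ->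
  int_entries (flatten [seq s j | j <- r]) (fun X => \prod_(j <- r) f j X) =
  (fun X => \prod_(j <- r) int_entries (s j) (f j) X).
Proof.
move=> + f0 sf; elim: r => [_|j r IH /= /andP[jr ur]].
  by apply/funext => X; rewrite /= !big_nil.
have prod0 r' (g : J -> 'M[R]_(m, n) -> \bar R) :
    (forall j, ge0_measurable (g j)) ->
    ge0_measurable (fun X => \prod_(j <- r') g j X).
  move=> g0; elim: r' => [|i r' [mp p0]].
    split=> [|X]; last by rewrite big_nil.
    under eq_fun do rewrite big_nil.
    exact: measurable_cst.
  have [mi i0] := g0 i; split=> [|X]; last by rewrite big_cons mule_ge0.
  under eq_fun do rewrite big_cons.
  exact: emeasurable_funM.
rewrite (_ : (fun X => _) = f j \* (fun X => \prod_(i <- r) f i X)); last first.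
  by apply/funext => X; rewrite big_cons.
rewrite /int_entries foldr_cat -!/(int_entries _ _) int_entriesZl//; last 2 first.
- exact: prod0.
- move=> k /flatten_mapP[i ir ks]; apply: sf ks.
  by apply: contraNneq jr => ->.
rewrite IH//.
transitivity (int_entries (s j)
    ((fun X => \prod_(i <- r) int_entries (s i) (f i) X) \* f j)).
  by congr int_entries; apply/funext => X /=; rewrite muleC.
rewrite int_entriesZl//; last 2 first.
- by apply: prod0 => i; exact: ge0_measurable_int_entries.
- move=> k ks X t; apply: eq_big_seq => i ir.
  apply: int_entries_free; apply: sf ks.
  by apply: contraNneq jr => <-.
by apply/funext => X; rewrite big_cons muleC.
Qed.

Definition set_entries q (h : 'I_q -> 'I_m * 'I_n) X (z : 'cV[R]_q) :=
  (\matrix_(i, j)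
    (if [pick k | h k == (i, j)] is Some k then z k ord0 else X i j))%R.

Lemma set_entries_in q (h : 'I_q -> 'I_m * 'I_n) X z i j (k : 'I_q) :
  injective h -> h k = (i, j) -> set_entries h X z i j = z k ord0.
Proof.
move=> hI hk; rewrite mxE; case: pickP => [l /eqP|/(_ k)]; last by rewrite hk eqxx.
by rewrite -hk => /hI ->.
Qed.

Lemma set_entries_out q (h : 'I_q -> 'I_m * 'I_n) X z i j :
  (forall k : 'I_q, h k <> (i, j)) -> set_entries h X z i j = X i j.
Proof. by move=> hij; rewrite mxE; case: pickP => // k /eqP/hij. Qed.

Lemma set_entries_consV q (h : 'I_q.+1 -> 'I_m * 'I_n) X t z : injective h ->
  set_entries h X (consV (t, z)) =
  set_entries (h \o lift ord0) (set_entry X (h ord0) t) z.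
Proof.
move=> hI; apply/matrixP => i j.
have hlI : injective (h \o lift ord0) by apply: inj_comp => //; exact: lift_inj.
have [[k hk]|hij] := pselect (exists k : 'I_q.+1, h k = (i, j)).
  rewrite (set_entries_in _ _ hI hk); case: (unliftP ord0 k) hk => [l|] ->.
    by move=> hl; rewrite consVS (@set_entries_in _ (h \o lift ord0) _ _ _ _ l).
  move=> h0; rewrite consV0 set_entries_out ?mxE ?h0 ?eqxx//= => l /=.
  by rewrite -h0 => /hI /eqP; rewrite eq_sym (negbTE (neq_lift _ _)).
rewrite !set_entries_out ?mxE; first by case: eqP => // ij; case: hij; exists ord0.
  by move=> l /= hl; apply: hij; exists (lift ord0 l).
by move=> l hl; apply: hij; exists l.
Qed.

Lemma measurable_set_entries q (h : 'I_q -> 'I_m * 'I_n) d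
    (T : measurableType d) (f : T -> 'M[R]_(m, n)) (g : T -> 'cV[R]_q) :
  measurable_fun setT f -> measurable_fun setT g ->
  measurable_fun setT (fun x => set_entries h (f x) (g x)).
Proof.
move=> mf mg; apply: measurable_fun_mxP => i j; under eq_fun do rewrite mxE.
case: pickP => [k _|_].
  apply: (measurableT_comp (f := fun X : 'cV[R]_q => X k ord0)) => //.
  exact: measurable_mx_entry.
apply: (measurableT_comp (f := fun X : 'M[R]_(m, n) => X i j)) => //.
exact: measurable_mx_entry.
Qed.

(** The bridge to Lebesgue measure on column vectors: both sides integrate the
    entries h 0, h 1, and so on, in this order. *)
Lemma int_entries_cV q (h : 'I_q -> 'I_m * 'I_n) F X :
  injective h -> ge0_measurable F ->
  int_entries [seq h k | k : 'I_q <- enum 'I_q] F X =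
  \int[lebesgue_cV R q]_z F (set_entries h X z).
Proof.
move=> + [mF F0]; have mFs q' (h' : 'I_q' -> 'I_m * 'I_n) Y :
    measurable_fun setT (fun z => F (set_entries h' Y z)).
  apply: measurableT_comp mF _; apply: measurable_set_entries.
    exact: measurable_cst.
  exact: measurable_id.
elim: q h X => [|q IH] h X hI.
  rewrite ge0_integral_cV0// (_ : enum _ = [::]) /=; last first.
    by apply: size0nil; rewrite size_enum_ord.
  by congr F; apply/matrixP => i j; rewrite set_entries_out// => -[].
rewrite ge0_integral_cVS// enum_ordSl /= -map_comp.
apply: eq_integral => t _; rewrite IH; last by apply: inj_comp => //; exact: lift_inj.
by apply: eq_integral => z _; rewrite set_entries_consV.
Qed.

End entrywise_integration.

(** * The inverse gamma integral *)

Section inverse_gamma_integral.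
Context (R : realType).
Implicit Types a b x : R.

Lemma measurable_inv : measurable_fun setT (fun x : R => x^-1).
Proof.
(* This product is also right at 0, whose inverse is 0. *)
rewrite (_ : (fun x => _) = (fun x => x * (x ^+ 2) `^ (-1))); last first.
  apply/funext => x; rewrite powR_inv1 ?sqr_ge0//.
  have [->|x0] := eqVneq x 0; first by rewrite invr0 mul0r.
  by field.
apply: measurable_funM => //.
by apply: (measurableT_comp (f := fun y : R => y `^ (-1))).
Qed.

Definition ig_kernel a b x : R := x `^ (- a - 1) * expR (- (b / x)).

Lemma measurable_ig_kernel a b : measurable_fun setT (ig_kernel a b).
Proof.
apply: measurable_funM; first exact: measurable_powR.
apply: measurableT_comp => //; apply: measurable_funN.
by apply: measurable_funM => //; exact: measurable_inv.
Qed.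

Lemma ig_kernel_ge0 a b x : 0 <= ig_kernel a b x.
Proof. by rewrite mulr_ge0 ?powR_ge0 ?expR_ge0. Qed.

Definition ig_integral a b : \bar R :=
  (\int[lebesgue_measure]_(x in `]0%R, +oo[) (ig_kernel a b x)%:E)%E.

(** A majorant that is integrable by an explicit primitive.  With u = 1 / x,
    the claim is (1 + u) ^ (a + 1) <= K ^ (a + 1) exp (b u), which follows from
    1 + v <= exp v at v = b u / (a + 1). *)
Lemma ig_kernel_le a b x : 0 < b -> 0 < a -> 0 < x ->
  let K := Num.max 1 ((a + 1) / b) in
  ig_kernel a b x <= K `^ (a + 1) * (1 + x) `^ (- a - 1).
Proof.
move=> b0 a0 x0; set K := Num.max _ _; move=> /=.
have a10 : 0 < a + 1 by rewrite addr_gt0.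
have K1 : 1 <= K by rewrite le_max lexx.
have K0 : 0 < K by exact: lt_le_trans K1.
have ux : 1 + x^-1 <= K * expR (b / (x * (a + 1))).
  have e1 := expR_ge1Dx (b / (x * (a + 1))).
  apply: le_trans (ler_wpM2l (ltW K0) e1).
  rewrite mulrDr mulr1 lerD//.
  have -> : b / (x * (a + 1)) = x^-1 * (b / (a + 1)).
    by field; rewrite !gt_eqF.
  rewrite mulrCA; apply: ler_peMr; first by rewrite invr_ge0 ltW.
  by rewrite -ler_pdivrMr ?divr_gt0// mul1r invf_div le_max lexx orbT.
have h : (1 + x^-1) `^ (a + 1) <=
    K `^ (a + 1) * expR (b / (x * (a + 1)) * (a + 1)).
  rewrite expRM -powRM ?expR_ge0 ?(ltW K0)//.
  apply: ge0_ler_powR => //; first exact: ltW.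
    by rewrite nnegrE addr_ge0// invr_ge0 ltW.
  by rewrite nnegrE mulr_ge0 ?expR_ge0// ltW.
rewrite /ig_kernel (_ : - a - 1 = - (a + 1)); last by ring.
rewrite !powRN expRN.
have -> : 1 + x = x * (1 + x^-1) by field; rewrite gt_eqF.
have u0 : 0 < 1 + x^-1 by rewrite addr_gt0// invr_gt0.
rewrite powRM ?(ltW x0) ?(ltW u0)//; set X := x `^ _; set W := (1 + x^-1) `^ _ in h *.
rewrite (_ : _ * (X * W)^-1 = X^-1 * (K `^ (a + 1) / W)); last first.
  by rewrite invfM mulrCA.
apply: ler_wpM2l; first by rewrite invr_ge0 powR_ge0.
rewrite ler_pdivlMr ?powR_gt0// ler_pdivrMl ?expR_gt0// mulrC.
apply: le_trans h _; rewrite ler_wpM2l ?powR_ge0// ler_expR.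
by rewrite le_eqVlt; apply/orP; left; apply/eqP; field; rewrite !gt_eqF.
Qed.

Lemma is_derive_continuous (f : R -> R) x df :
  is_derive x 1 f df -> {for x, continuous f}.
Proof.
by move=> [dfx _]; apply/differentiable_continuous/derivable1_diffP.
Qed.

Lemma is_derive_powR_shift (c p x : R) : 0 < c + x ->
  is_derive x 1 (fun y => (c + y) `^ p) (p * (c + x) `^ (p - 1)).
Proof.
move=> cx.
have D : is_derive x 1 (fun y => c + y) 1.
  by have := is_deriveD (is_derive_cst c x (1 : R)) (is_derive_id x (1 : R));
    rewrite add0r.
have := @is_derive1_comp R (fun y => y `^ p) (fun y => c + y) x _ _
  (is_derive1_powR p cx) D.
by rewrite mulr1.
Qed.

Lemma integral_is_derive (f F : R -> R) a b : a < b ->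
  (forall x, a <= x <= b -> is_derive x 1 F (f x)) ->
  (forall x, a <= x <= b -> {for x, continuous f}) ->
  (\int[lebesgue_measure]_(x in `[a, b]) (f x)%:E = (F b - F a)%:E)%E.
Proof.
move=> ab dF cf; rewrite (continuous_FTC2 ab (F := F)) ?EFinB//.
- apply: continuous_in_subspaceT => x; rewrite inE/= in_itv/=.
  exact: cf.
- split.
  + move=> x; rewrite in_itv/= => /andP[/ltW ax /ltW xb].
    by have [] := dF x; rewrite ?ax.
  + apply: cvg_at_right_filter; apply: is_derive_continuous (dF a _).
    by rewrite lexx ltW.
  + apply: cvg_at_left_filter; apply: is_derive_continuous (dF b _).
    by rewrite lexx ltW.
- move=> x; rewrite in_itv/= => /andP[/ltW ax /ltW xb].
  have := dF x; rewrite ax xb => /(_ isT) D.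
  by rewrite derive1E derive_val.
Qed.

Let bigcup_itv1 : \bigcup_n `[0 : R, n.+1%:R]%classic = `[0, +oo[%classic.
Proof.
apply/seteqP; split=> [x [n _]|x] /=; rewrite !in_itv/= ?andbT.
  by case/andP.
move=> x0; exists (Num.truncn x) => //=; rewrite in_itv/= x0/=.
by rewrite ltW// truncnS_gt.
Qed.

Lemma integral_shifted_power_le a : 0 < a ->
  (\int[lebesgue_measure]_(x in `[0%R, +oo[) ((1 + x) `^ (- a - 1))%:E <=
   (a^-1)%:E)%E.
Proof.
move=> a0; pose f x : \bar R := ((1 + x) `^ (- a - 1))%:E.
have mf : measurable_fun setT f.
  apply/measurable_EFinP.
  apply: (measurableT_comp (f := fun y : R => y `^ (- a - 1))) => //.
  by apply: measurable_funD.
have nd : nondecreasing_seq (fun n : nat => `[0 : R, n.+1%:R]%classic).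
  move=> n k nk; apply/subsetPset => x /=; rewrite !in_itv/=.
  by move=> /andP[-> /le_trans]; apply; rewrite ler_nat.
have cv : (\int[lebesgue_measure]_(x in `[0%R, i.+1%:R]) f x)%E @[i --> \oo]
    --> (\int[lebesgue_measure]_(x in `[0%R, +oo[) f x)%E.
  rewrite -bigcup_itv1; apply: ge0_nondecreasing_set_cvg_integral => //.
  - by move=> i; exact: measurable_funTS.
  - by move=> i x _; rewrite lee_fin powR_ge0.
rewrite -[leLHS](cvg_lim _ cv)//; apply: lime_le.
  by apply/cvg_ex; eexists; exact: cv.
apply: nearW => n.
pose F x := - a^-1 * (1 + x) `^ (- a).
have -> : (\int[lebesgue_measure]_(x in `[0%R, n.+1%:R]) f x =
    (F n.+1%:R - F 0)%:E)%E.
  apply: integral_is_derive => //.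
  - move=> x /andP[x0 _].
    have := is_deriveZ (- a^-1) (@is_derive_powR_shift 1 (- a) x _).
    rewrite ltr_pwDl// => /(_ isT) D; apply: (@is_derive_eq _ _ _ _ _ _ _ _ D).
    by rewrite /GRing.scale/= mulrA mulrNN mulVf ?mul1r ?gt_eqF.
  - move=> x /andP[x0 _]; apply: is_derive_continuous (is_derive_powR_shift _ _).
    by rewrite ltr_pwDl.
rewrite /F addr0 powR1 lee_fin mulr1 mulNr opprK gerDr oppr_le0.
by rewrite mulr_ge0 ?powR_ge0 ?invr_ge0 ?ltW.
Qed.

Lemma ig_integral_lty a b : 0 < a -> 0 < b -> (ig_integral a b < +oo)%E.
Proof.
move=> a0 b0; set K := Num.max 1 ((a + 1) / b).
apply: (@le_lt_trans _ _ (\int[lebesgue_measure]_(x in `]0%R, +oo[)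
    ((K `^ (a + 1))%:E * ((1 + x) `^ (- a - 1))%:E))%E).
  apply: ge0_le_integral => //.
  - by move=> x _; rewrite lee_fin ig_kernel_ge0.
  - by apply/measurable_EFinP; exact: measurable_funTS (measurable_ig_kernel _ _).
  - apply: measurable_funTS; apply/measurable_EFinP; apply: measurable_funM => //.
    apply: (measurableT_comp (f := fun y : R => y `^ (- a - 1))) => //.
    by apply: measurable_funD.
  - move=> x /=; rewrite in_itv/= andbT => x0.
    by rewrite -EFinM lee_fin; exact: ig_kernel_le.
have mf : measurable_fun setT (fun x : R => ((1 + x) `^ (- a - 1))%:E).
  apply/measurable_EFinP.
  apply: (measurableT_comp (f := fun y : R => y `^ (- a - 1))) => //.
  by apply: measurable_funD.
rewrite ge0_integralZl_EFin ?powR_ge0//; last 2 first.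
- by move=> x _; rewrite lee_fin powR_ge0.
- exact: measurable_funTS.
apply: (@le_lt_trans _ _ ((K `^ (a + 1))%:E * (a^-1)%:E)%E); last first.
  by rewrite -EFinM ltry.
apply: lee_wpmul2l; first by rewrite lee_fin powR_ge0.
apply: le_trans (integral_shifted_power_le a0).
rewrite -integral_itv_obnd_cbnd//.
exact: measurable_funTS.
Qed.

(** For a <= 0 the kernel is at least exp (- b) / x on [1, +oo[, and the
    logarithm is unbounded. *)
Lemma ig_integral_pinfty a b : a <= 0 -> 0 < b -> ig_integral a b = +oo%E.
Proof.
move=> a0 b0; apply/eqyP => M M0.
have [n Mn] : exists n : nat, M * expR b <= ln n.+2%:R.
  exists (Num.truncn (expR (M * expR b))).
  rewrite -[leLHS]expRK ler_ln ?posrE ?expR_gt0//.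
  by rewrite ltW// (lt_trans (truncnS_gt _))// ltr_nat.
apply: (@le_trans _ _ (\int[lebesgue_measure]_(x in `[1%R, n.+2%:R])
    ((expR (- b))%:E * (x^-1)%:E))%E).
  rewrite ge0_integralZl_EFin ?expR_ge0//; last 2 first.
  - move=> x /=; rewrite in_itv/= => /andP[x1 _].
    by rewrite lee_fin invr_ge0 (le_trans _ x1).
  - by apply: measurable_funTS; apply/measurable_EFinP; exact: measurable_inv.
  have -> : (\int[lebesgue_measure]_(x in `[1%R, n.+2%:R]) (x^-1)%:E =
      (ln n.+2%:R - ln 1)%:E :> \bar R)%E.
    apply: integral_is_derive.
    - by rewrite ltr1n.
    - by move=> x /andP[x1 _]; apply: is_derive1_ln; exact: lt_le_trans x1.
    - move=> x /andP[x1 _]; apply: inv_continuous.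
      by rewrite gt_eqF// (lt_le_trans _ x1).
  rewrite ln1 subr0 -EFinM lee_fin expRN -ler_pdivrMl ?invr_gt0 ?expR_gt0//.
  by rewrite invrK mulrC.
apply: (@le_trans _ _ (\int[lebesgue_measure]_(x in `[1%R, n.+2%:R])
    (ig_kernel a b x)%:E)%E).
  apply: ge0_le_integral => //.
  - move=> x /=; rewrite in_itv/= => /andP[x1 _].
    by rewrite -EFinM lee_fin mulr_ge0 ?expR_ge0 ?invr_ge0 ?(le_trans _ x1).
  - apply: measurable_funTS; apply/measurable_EFinP; apply: measurable_funM => //.
    exact: measurable_inv.
  - by apply: measurable_funTS; apply/measurable_EFinP; exact: measurable_ig_kernel.
  - move=> x /=; rewrite in_itv/= => /andP[x1 _].
    rewrite -EFinM lee_fin mulrC /ig_kernel; apply: ler_pM.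
    + by rewrite invr_ge0 (le_trans _ x1).
    + exact: expR_ge0.
    + rewrite -powR_inv1 ?(le_trans _ x1)//; apply: ler_powR => //.
      by rewrite lerDr oppr_ge0.
    + rewrite ler_expR lerN2 ler_pdivrMr; last exact: lt_le_trans x1.
      by rewrite ler_peMr// ltW.
apply: ge0_subset_integral => //.
- by apply: measurable_funTS; apply/measurable_EFinP; exact: measurable_ig_kernel.
- by move=> x _; rewrite lee_fin ig_kernel_ge0.
- move=> x /=; rewrite !in_itv/= andbT => /andP[x1 _].
  exact: lt_le_trans x1.
Qed.

End inverse_gamma_integral.

(** * Reduction to the Gamma function *)

Section gamma_substitution.
Context (R : realType).
Implicit Types a b x y : R.

(** Positivity is needed to divide by the integral when normalizing. *)
Lemma ig_integral_gt0 a b : 0 < a -> 0 < b -> (0 < ig_integral a b)%E.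
Proof.
move=> a0 b0; pose c := 2 `^ (- a - 1) * expR (- b).
have c0 : 0 < c by rewrite mulr_gt0 ?powR_gt0 ?expR_gt0.
have mk D : measurable_fun D (fun x => (ig_kernel a b x)%:E).
  by apply: measurable_funTS; apply/measurable_EFinP; exact: measurable_ig_kernel.
apply: (@lt_le_trans _ _ (\int[lebesgue_measure]_(x in `[1%R, 2%R]) c%:E)%E).
  rewrite integral_cst//= lebesgue_measure_itv/= lte_fin ltr1n.
  by rewrite -EFinB -EFinM lte_fin mulr_gt0// subr_gt0 ltr1n.
apply: (@le_trans _ _ (\int[lebesgue_measure]_(x in `[1%R, 2%R])
    (ig_kernel a b x)%:E)%E).
  apply: ge0_le_integral => //.
  - by move=> x _; rewrite lee_fin ltW.
  - exact: mk.
  - move=> x /=; rewrite in_itv/= => /andP[x1 x2].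
    have x0 : 0 < x by exact: lt_le_trans x1.
    have e : - a - 1 = - (a + 1) by ring.
    rewrite lee_fin /c /ig_kernel; apply: ler_pM => //.
    + rewrite e !powRN lef_pV2 ?posrE ?powR_gt0//.
      apply: ge0_ler_powR => //; first by rewrite addr_ge0// ltW.
        by rewrite nnegrE ltW.
      by rewrite nnegrE.
    + by rewrite ler_expR lerN2 ler_pdivrMr// ler_peMr// ltW.
apply: ge0_subset_integral => //; first exact: mk.
- by move=> x _; rewrite lee_fin ig_kernel_ge0.
- move=> x /=; rewrite !in_itv/= andbT => /andP[x1 _].
  exact: lt_le_trans x1.
Qed.

(** The substitution x = b / y is singular at 0, so it is made on compact
    intervals exhausting ]0, +oo[; these are chosen so that b / y maps
    pos_itv 1 n onto pos_itv b n. *)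
Let pos_itv c n : set R := `[c / n.+1%:R, c * n.+1%:R]%classic.

Let bigcup_pos_itv c : 0 < c -> \bigcup_n pos_itv c n = `]0, +oo[%classic.
Proof.
move=> c0; apply/seteqP; split=> [x [n _]|x]; rewrite /pos_itv /= !in_itv/= ?andbT.
  by move=> /andP[+ _]; apply: lt_le_trans; rewrite divr_gt0.
move=> x0; pose y := Num.max (c / x) (x / c); exists (Num.truncn y) => //=.
have := truncnS_gt y; set N := _.+1%:R.
rewrite gt_max !ltr_pdivrMr// => /andP[h1 h2]; rewrite in_itv/=.
by rewrite ler_pdivrMr ?ltr0n// [x * _]mulrC [c * _]mulrC !ltW.
Qed.

Let pos_itv_nd c : 0 < c -> nondecreasing_seq (pos_itv c).
Proof.
move=> c0 n k nk; apply/subsetPset => x; rewrite /pos_itv /= !in_itv/=.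
move=> /andP[h1 h2]; apply/andP; split.
  apply: le_trans h1; rewrite ler_pM2l// lef_pV2 ?posrE ?ltr0n//.
  by rewrite ler_nat.
by apply: le_trans h2 _; rewrite ler_pM2l// ler_nat.
Qed.

Lemma cvg_pos_itv c (f : R -> R) : 0 < c -> measurable_fun setT f ->
  (forall x, 0 <= f x) ->
  ((\int[lebesgue_measure]_(x in pos_itv c n) (f x)%:E)%E @[n --> \oo] -->
  (\int[lebesgue_measure]_(x in `]0%R, +oo[) (f x)%:E)%E).
Proof.
move=> c0 mf f0; rewrite -(bigcup_pos_itv c0).
apply: ge0_nondecreasing_set_cvg_integral.
- exact: pos_itv_nd.
- by move=> i; exact: measurable_itv.
- by move=> i; apply: measurable_funTS; exact/measurable_EFinP.
- by move=> i x _; rewrite lee_fin.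
Qed.

Let is_derive_div b x : 0 < x -> is_derive x 1 (fun y => b / y) (- (b / x ^+ 2)).
Proof.
move=> x0.
have := is_deriveZ b (@is_deriveV _ id x 1 1 _ _).
rewrite /= gt_eqF// => /(_ isT (is_derive_id _ _)) D.
apply: (@is_derive_eq _ _ _ _ _ _ _ _ D).
by rewrite /GRing.scale/= mulr1 mulrN.
Qed.

Let continuous_derive_div b x : 0 < x ->
  {for x, continuous (derive1 (fun y => b / y))}.
Proof.
move=> x0.
have c : {for x, continuous (fun y => - (b / y ^+ 2))}.
  apply: continuousN; apply: continuousM; first exact: cst_continuous.
  apply: continuousV; first by rewrite expf_neq0// gt_eqF.
  exact: exprn_continuous.
have e : \forall y \near x, - (b / y ^+ 2) = (derive1 (fun y => b / y)) y.
  near=> y; have y0 : 0 < y by near: y; exact: lt_nbhsr.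
  by have D := is_derive_div b y0; rewrite derive1E derive_val.
apply: cvg_trans (near_eq_cvg e) _ => /=.
have <- : - (b / x ^+ 2) = (derive1 (fun y => b / y)) x by exact: nbhs_singleton e.
exact: c.
Unshelve. all: by end_near. Qed.

Lemma continuous_ig_kernel a b x : 0 < x -> {for x, continuous (ig_kernel a b)}.
Proof.
move=> x0; apply: continuousM.
  exact: is_derive_continuous (is_derive1_powR _ x0).
apply: continuous_comp; last exact: continuous_expR.
by apply: continuousN; exact: is_derive_continuous (is_derive_div b x0).
Qed.

Lemma ig_integral_subst a b : 0 < b ->
  ig_integral a b = ((b `^ (- a))%:E *
    \int[lebesgue_measure]_(y in `]0%R, +oo[) (y `^ (a - 1) * expR (- y))%:E)%E.
Proof.
move=> b0; pose g y := y `^ (a - 1) * expR (- y).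
have mg : measurable_fun setT g.
  apply: measurable_funM; first exact: measurable_powR.
  by apply: measurableT_comp => //; exact: measurable_funN.
have g0 y : 0 <= g y by rewrite mulr_ge0 ?powR_ge0 ?expR_ge0.
have cx := cvg_pos_itv b0 (measurable_ig_kernel a b) (ig_kernel_ge0 a b).
have cy := cvg_pos_itv ltr01 mg g0.
have step n : (\int[lebesgue_measure]_(x in pos_itv b n) (ig_kernel a b x)%:E =
    (b `^ (- a))%:E * \int[lebesgue_measure]_(y in pos_itv 1 n) (g y)%:E)%E.
  rewrite -ge0_integralZl_EFin ?powR_ge0//; last 3 first.
  - exact: measurable_itv.
  - by move=> y _; rewrite lee_fin.
  - by apply: measurable_funTS; exact/measurable_EFinP.
  have n0 : 0 < n.+1%:R :> R by rewrite ltr0n.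
  have l0 : 0 < 1 / n.+1%:R :> R by rewrite divr_gt0.
  have pos y : 1 / n.+1%:R <= y -> 0 < y by exact: lt_le_trans.
  have ab : 1 / n.+1%:R <= 1 * n.+1%:R :> R.
    by rewrite ler_pdivrMr// mul1r -natrM ler1n.
  have Fl : b / (1 / n.+1%:R) = b * n.+1%:R by field; rewrite gt_eqF.
  have Fr : b / (1 * n.+1%:R) = b / n.+1%:R by rewrite mul1r.
  rewrite /pos_itv -Fl -Fr.
  rewrite (@integration_by_substitution_decreasing _ (fun y => b / y))//.
  - apply: eq_integral => y; rewrite inE/= in_itv/= => /andP[/pos y0 _].
    rewrite -EFinM; congr EFin.
    have D := is_derive_div b y0.
    rewrite !fctE derive1E derive_val opprK /ig_kernel /g invf_div mulrA.
    rewrite [b * (y / b)]mulrCA divff ?gt_eqF// mulr1.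
    have [bn0 yn0] : b != 0 /\ y != 0 by rewrite !gt_eqF.
    have -> : (b / y) `^ (- a - 1) = b `^ (- a) * y `^ (a - 1) * (y ^+ 2 / b).
      rewrite powRM ?invr_ge0 ?(ltW b0) ?(ltW y0)//.
      have -> : b `^ (- a - 1) = b `^ (- a) / b.
        by rewrite powRD ?bn0 ?implybT// powR_inv1 ?ltW.
      rewrite -[y^-1]powR_inv1 ?(ltW y0)// -powRrM.
      have -> : -1 * (- a - 1) = (a - 1) + 2 by ring.
      rewrite powRD ?yn0 ?implybT// powR_mulrn ?(ltW y0)//.
      by field.
    by field; rewrite bn0 yn0.
  - move=> x y; rewrite !in_itv/= => /andP[/pos x0 _] /andP[/pos y0 _] xy.
    by rewrite ltr_pM2l// ltf_pV2.
  - move=> y; rewrite in_itv/= => /andP[/ltW/pos y0 _].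
    exact: continuous_derive_div.
  - apply/cvg_ex; eexists; apply: cvg_at_right_filter.
    exact: continuous_derive_div.
  - apply/cvg_ex; eexists; apply: cvg_at_left_filter.
    by apply: continuous_derive_div; exact: pos.
  - split.
    + move=> y; rewrite in_itv/= => /andP[/ltW/pos y0 _].
      by have [] := is_derive_div b y0.
    + apply: cvg_at_right_filter.
      exact: is_derive_continuous (is_derive_div b l0).
    + apply: cvg_at_left_filter.
      exact: is_derive_continuous (is_derive_div b (pos _ ab)).
  - apply: continuous_in_subspaceT => x; rewrite inE/= in_itv/= => /andP[h _].
    apply: continuous_ig_kernel; apply: lt_le_trans h.
    by rewrite Fr divr_gt0.
have {}cx : ((b `^ (- a))%:E * \int[lebesgue_measure]_(y in pos_itv 1 n)
    (g y)%:E)%E @[n --> \oo] --> ig_integral a b.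
  by apply: cvg_trans cx; under eq_fun do rewrite -step; exact: cvg_refl.
by apply: cvg_unique cx _ => //; exact: cvgeZl.
Qed.

Lemma Gamma_integral a : 0 < a ->
  (\int[lebesgue_measure]_(y in `]0%R, +oo[) (y `^ (a - 1) * expR (- y))%:E =
   (Gamma a)%:E)%E /\ 0 < Gamma a.
Proof.
move=> a0; have := ig_integral_gt0 a0 ltr01; have := ig_integral_lty a0 ltr01.
rewrite ig_integral_subst// powR1 mul1e /Gamma /Rintegral.
by case: (integral _ _ _) => [r||]//= _; rewrite lte_fin.
Qed.

Lemma ig_integralE a b : 0 < a -> 0 < b ->
  ig_integral a b = (Gamma a / b `^ a)%:E.
Proof.
move=> a0 b0; rewrite ig_integral_subst//; have [-> _] := Gamma_integral a0.
by rewrite -EFinM powRN mulrC.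
Qed.

End gamma_substitution.

(** * Factorization of the kernel over the vertices *)

Section kernel_blocks.
Context (R : realType) (p : nat) (e : rel 'I_p) (U : 'M[R]_p).
Implicit Types (i j : 'I_p) (L : 'M[R]_p).
Hypothesis pU : posdefmx U.

Let Usym i j : U i j = U j i.
Proof. by case: pU => Us _; rewrite -{1}Us mxE. Qed.

Lemma pa_irrefl i : i \in pa e i = false.
Proof. by rewrite inE eqxx. Qed.

Lemma enum_val_pa_neq i (k : 'I_#|pa e i|) : (enum_val k == i) = false.
Proof. by have := enum_valP k; rewrite inE => /andP[/negbTE]. Qed.

Lemma big_pa_support i (F : 'I_p -> R) :
  (forall j, j != i -> j \notin pa e i -> F j = 0) ->
  \sum_j F j = F i + \sum_(k < #|pa e i|) F (enum_val k).
Proof.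
move=> F0; rewrite (bigD1 i)//=; congr (_ + _).
rewrite (bigID [in pa e i])/= [X in _ + X]big1 ?addr0; last first.
  by move=> j /andP[ji]; exact: F0.
rewrite -(big_enum_val (A := [in pa e i]) F); apply: eq_bigl => j.
by rewrite !inE; case: eqP.
Qed.

(** For a vector supported on a vertex and its parents, only the blocks of U
    that belong to this vertex enter; column i of L is such a vector. *)
Lemma qform_pa_support i (y : 'cV[R]_p) :
  (forall j, j != i -> j \notin pa e i -> y j ord0 = 0) ->
  let l := \col_(k < #|pa e i|) y (enum_val k) ord0 in
  qform U y = y i ord0 ^+ 2 * U i i +
    2 * y i ord0 * (l^T *m pa_col e U i) ord0 ord0 + qform (pa_mx e U i) l.
Proof.
move=> y0 l; rewrite qformE (big_pa_support (i := i)); last first.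
  by move=> j ji jp; rewrite big1// => k _; rewrite (y0 j)// !mul0r.
have inner j : \sum_k y j ord0 * U j k * y k ord0 =
    y j ord0 * U j i * y i ord0 +
    \sum_(k < #|pa e i|) y j ord0 * U j (enum_val k) * y (enum_val k) ord0.
  by apply: big_pa_support => k ki kp; rewrite (y0 k)// mulr0.
have -> : (l^T *m pa_col e U i) ord0 ord0 =
    \sum_(k < #|pa e i|) y (enum_val k) ord0 * U (enum_val k) i.
  by rewrite mxE; apply: eq_bigr => k _; rewrite !mxE.
rewrite qformE inner -addrA.
under [X in _ + (_ + X)]eq_bigr do rewrite inner.
rewrite big_split/= addrA [in RHS]mulr_sumr addrA; congr (_ + _); last first.
  apply: eq_bigr => k _; apply: eq_bigr => k' _.
  by rewrite !mxE.
rewrite -addrA -big_split/= expr2; congr (_ + _); first by ring.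
by apply: eq_bigr => k _; rewrite (Usym i); ring.
Qed.

(** Extend a vector indexed by the parents by zero. *)
Lemma posdef_pa_mx i : posdefmx (pa_mx e U i).
Proof.
split=> [|x x0]; first by apply/matrixP => k l; rewrite !mxE Usym.
pose y : 'cV[R]_p := \col_j
  (if [pick k : 'I_#|pa e i| | enum_val k == j] is Some k then x k ord0 else 0).
have yx k : y (enum_val k) ord0 = x k ord0.
  rewrite mxE; case: pickP => [l /eqP/enum_val_inj -> //|/(_ k)].
  by rewrite eqxx.
have yi : y i ord0 = 0.
  rewrite mxE; case: pickP => // k; by rewrite enum_val_pa_neq.
have := @qform_pa_support i y; rewrite yi expr0n/= mul0r mulr0 mul0r !add0r.
have -> : \col_(k < #|pa e i|) y (enum_val k) ord0 = x.
  by apply/matrixP => k l; rewrite (ord1 l) !mxE -yx mxE.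
rewrite /qform => <-.
  have [_] := pU; apply; apply: contra_neq x0 => y0.
  by apply/matrixP => k l; rewrite (ord1 l) -yx y0 !mxE.
move=> j ji jp; rewrite mxE; case: pickP => // k /eqP kj.
by have := enum_valP k; rewrite kj (negbTE jp).
Qed.

(** The coefficients of the linear regression of coordinate i on its parents. *)
Definition reg_coef i : 'cV[R]_#|pa e i| := invmx (pa_mx e U i) *m pa_col e U i.

(** Completing the square in l: the minimum over l of the quadratic form is the
    Schur complement, and it is attained at minus the regression coefficients. *)
Lemma qform_complete_square i (l : 'cV[R]_#|pa e i|) :
  U i i + 2 * (l^T *m pa_col e U i) ord0 ord0 + qform (pa_mx e U i) l =
  pa_schur e U i + qform (pa_mx e U i) (l + reg_coef i).
Proof.
set A := pa_mx e U i; set u := pa_col e U i.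
have [As _] := posdef_pa_mx i.
have uA : A \in unitmx.
  by rewrite unitmxE unitfE gt_eqF// posdef_det_gt0//; exact: posdef_pa_mx.
have Vs : (invmx A)^T = invmx A by rewrite trmx_inv As.
rewrite /pa_schur (_ : pa_row e U i = u^T); last first.
  by apply/matrixP => k j; rewrite !mxE Usym.
rewrite /qform -/A -/u /reg_coef -/A -/u.
have -> : (l + invmx A *m u)^T = l^T + u^T *m invmx A.
  by rewrite linearD/= trmx_mul Vs.
rewrite !(mulmxDl, mulmxDr).
rewrite -!mulmxA !(mulKVmx uA) !mulmxA !mulmxKV//.
have -> : u^T *m l = l^T *m u.
  by apply/matrixP => k j; rewrite !ord1 !mxE; apply: eq_bigr => h _; rewrite !mxE mulrC.
rewrite !mxE; ring.
Qed.

End kernel_blocks.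

(** * Coordinates arranged by vertex *)

Section chol_coordinates.
Context (R : realType) (p : nat) (e : rel 'I_p).
Implicit Types (i j : 'I_p) (z : 'cV[R]_p * 'cV[R]_#|edge_entries e|).

Lemma in_edge_entries j i : ((j, i) \in edge_entries e) = (j \in pa e i).
Proof. by rewrite inE. Qed.

Lemma chol_coord_D z i : (chol_coord z).1 i i = z.1 i ord0.
Proof. by rewrite !mxE eqxx mulr1n. Qed.

Lemma chol_coord_L z i j : (chol_coord z).2 i j =
  (i == j)%:R + \sum_k z.2 k ord0 * ((i, j) == enum_val k)%:R.
Proof.
rewrite !mxE summxE; congr (_ + _); apply: eq_bigr => k _; rewrite !mxE.
by case: (enum_val k).
Qed.

Lemma chol_coord_L_edge z i j k : enum_val k = (i, j) ->
  (chol_coord z).2 i j = z.2 k ord0.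
Proof.
move=> kij; rewrite chol_coord_L; have [ij|_] := eqVneq i j.
  by have := enum_valP k; rewrite kij in_edge_entries ij pa_irrefl.
rewrite add0r (bigD1 k)//= kij eqxx mulr1 big1 ?addr0// => k' k'k.
rewrite -kij; case: eqP => [/enum_val_inj kk|]; last by rewrite mulr0.
by rewrite kk eqxx in k'k.
Qed.

Lemma chol_coord_L_nonedge z i j : i \notin pa e j ->
  (chol_coord z).2 i j = (i == j)%:R.
Proof.
move=> ij; rewrite chol_coord_L big1 ?addr0// => k _.
case: eqP => [kij|]; last by rewrite mulr0.
by have := enum_valP k; rewrite -kij in_edge_entries (negbTE ij).
Qed.

Lemma chol_coord_ThetaD z : parent_ordered e ->
  ThetaD e (chol_coord z) <-> forall i, 0 < z.1 i ord0.
Proof.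
move=> po; split=> [[_ D0 _] i|z0]; first by rewrite -chol_coord_D.
split; first exact: diag_mx_is_diag.
  by move=> i; rewrite chol_coord_D.
split=> [i j ij|i|i j ij ijp].
- rewrite chol_coord_L_nonedge.
    by case: eqP ij => // ->; rewrite ltnn.
  by apply/negP; rewrite inE => /andP[_ /po]; rewrite ltnNge (ltnW ij).
- by rewrite chol_coord_L_nonedge ?eqxx// pa_irrefl.
- by rewrite chol_coord_L_nonedge// (negbTE ij).
Qed.

Definition diag_entry i : 'I_p * 'I_p := (i, i).
Definition edge_entry (k : 'I_#|edge_entries e|) : 'I_p * 'I_p := enum_val k.
Definition pa_entry i (k : 'I_#|pa e i|) : 'I_p * 'I_p := (enum_val k, i).

Lemma diag_entry_inj : injective diag_entry.
Proof. by move=> i j []. Qed.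

Lemma edge_entry_inj : injective edge_entry.
Proof. exact: enum_val_inj. Qed.

Lemma pa_entry_inj i : injective (@pa_entry i).
Proof. by move=> k l [] /enum_val_inj. Qed.

(** Since L has unit diagonal, its diagonal is free to carry D: in this single
    matrix column i holds D_ii and the free entries of column i of L, so that
    the blocks of the factorization are disjoint columns. *)
Definition coord_mx z : 'M[R]_p :=
  set_entries edge_entry (set_entries diag_entry 0 z.1) z.2.

Lemma coord_mx_diag z i : coord_mx z i i = z.1 i ord0.
Proof.
rewrite /coord_mx set_entries_out => [|k ki].
  exact: (set_entries_in _ _ diag_entry_inj).
by have := enum_valP k; rewrite -/(edge_entry k) ki in_edge_entries pa_irrefl.
Qed.

Lemma coord_mx_pa z i : pa_col e (coord_mx z) i = pa_col e (chol_coord z).2 i.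
Proof.
apply/matrixP => k l; rewrite mxE [RHS]mxE.
have ein : (enum_val k, i) \in edge_entries e.
  by rewrite in_edge_entries enum_valP.
pose r := enum_rank_in ein (enum_val k, i).
have rE : edge_entry r = (enum_val k, i) by exact: enum_rankK_in.
by rewrite (chol_coord_L_edge _ rE) (set_entries_in _ _ edge_entry_inj rE).
Qed.

Definition block_entries i : seq ('I_p * 'I_p) :=
  [seq (j, i) | j <- i :: enum (pa e i)].

Lemma map_enum_val (T : finType) (A : {set T}) :
  [seq enum_val k | k <- enum 'I_#|A|] = enum A.
Proof.
case: (pickP [in A]) => [x0 _|A0].
  apply: (@eq_from_nth _ x0); rewrite size_map size_enum_ord ?cardE// => k kA.
  rewrite (nth_map (Ordinal kA)) ?size_enum_ord// (enum_val_nth x0).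
  by rewrite nth_enum_ord.
have /cards0_eq -> : #|A| = 0%N by apply: eq_card0.
by rewrite enum_set0; apply: size0nil; rewrite size_map size_enum_ord cards0.
Qed.

Lemma block_entriesE i :
  block_entries i = diag_entry i :: [seq pa_entry k | k <- enum 'I_#|pa e i|].
Proof.
rewrite /block_entries /= -map_enum_val -map_comp.
by congr cons; apply: eq_map.
Qed.

Lemma coord_entries_perm :
  perm_eq ([seq diag_entry i | i <- enum 'I_p] ++
           [seq edge_entry k | k <- enum 'I_#|edge_entries e|])
          (flatten [seq block_entries i | i <- enum 'I_p]).
Proof.
have -> : [seq edge_entry k | k <- enum 'I_#|edge_entries e|] =
    enum (edge_entries e) by exact: map_enum_val.
apply: uniq_perm.
- rewrite cat_uniq enum_uniq andbT map_inj_uniq ?enum_uniq/=; last exact: diag_entry_inj.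
  apply/hasPn => -[j i]; rewrite mem_enum in_edge_entries => ij.
  by apply/mapP => -[k _ [jk ik]]; rewrite jk ik pa_irrefl in ij.
- apply: (@allpairs_uniq_dep _ (fun=> 'I_p) _ (fun i j => (j, i))).
  + exact: enum_uniq.
  + by move=> i _ /=; rewrite enum_uniq mem_enum pa_irrefl.
  + by move=> [i j] [i' j'] _ _ /= [-> ->].
- move=> [j i]; rewrite mem_cat mem_enum in_edge_entries.
  apply/orP/flatten_mapP => [[/mapP[k _ [-> ->]]|ij]|[k _ /mapP[l]]].
  + by exists k; rewrite ?mem_enum// inE eqxx.
  + by exists i; rewrite ?mem_enum// map_f// inE mem_enum ij orbT.
  + rewrite inE mem_enum => + [-> ->] => /orP[/eqP ->|lk]; last by right.
    by left; apply/mapP; exists k; rewrite ?mem_enum.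
Qed.

Lemma measurable_pa_col i d (T : measurableType d) (f : T -> 'M[R]_p) :
  measurable_fun setT f -> measurable_fun setT (fun x => pa_col e (f x) i).
Proof.
move=> mf; apply: measurable_fun_mxP => k l; under eq_fun do rewrite mxE.
apply: (measurableT_comp (f := fun X : 'M[R]_p => X (enum_val k) i)) => //.
exact: measurable_mx_entry.
Qed.

(** The coordinates are integrated first over D and then over the edges, while
    the factorization wants them vertex by vertex; the two orders are
    permutations of each other. *)
Lemma ge0_integral_chol_coord (g : forall i, R * 'cV[R]_#|pa e i| -> \bar R) :
  (forall i, measurable_fun setT (g i)) -> (forall i x, (0 <= g i x)%E) ->
  (\int[lebesgue_cV R p \x lebesgue_cV R #|edge_entries e|]_z
     \prod_i g i ((chol_coord z).1 i i, pa_col e (chol_coord z).2 i) =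
   \prod_i \int[lebesgue_measure]_d
     \int[lebesgue_cV R #|pa e i|]_l g i (d, l))%E.
Proof.
move=> mg g0; pose f i (X : 'M[R]_p) := g i (X i i, pa_col e X i).
have f0 i : ge0_measurable (f i).
  split=> [|X]; last exact: g0.
  apply: measurableT_comp (mg i) _; apply/measurable_fun_pair.
    exact: measurable_mx_entry.
  by apply: measurable_pa_col; exact: measurable_id.
pose F X := (\prod_(i <- enum 'I_p) f i X)%E.
have F0 : ge0_measurable F.
  rewrite /F; elim: (enum 'I_p) => [|i r [mr r0]].
    split=> [|X]; last by rewrite big_nil.
    by under eq_fun do rewrite big_nil; exact: measurable_cst.
  have [mi i0] := f0 i; split=> [|X]; last by rewrite big_cons mule_ge0.
  by under eq_fun do rewrite big_cons; exact: emeasurable_funM.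
transitivity (\int[lebesgue_cV R p \x lebesgue_cV R #|edge_entries e|]_z
    F (coord_mx z))%E.
  apply: eq_integral => z _; rewrite /F big_enum/=; apply: eq_bigr => i _.
  by rewrite /f coord_mx_diag coord_mx_pa chol_coord_D.
have mF : measurable_fun setT (F \o coord_mx).
  apply: measurableT_comp; first by case: F0.
  apply: measurable_set_entries; last exact: measurable_snd.
  by apply: measurable_set_entries; [exact: measurable_cst|exact: measurable_fst].
rewrite (fubini_tonelli1 (F \o coord_mx))//; last first.
  by move=> x; have [_] := F0; exact.
transitivity (int_entries ([seq diag_entry i | i <- enum 'I_p] ++
    [seq edge_entry k | k <- enum 'I_#|edge_entries e|]) F 0).
  rewrite /int_entries foldr_cat -!/(int_entries _ _).
  rewrite (int_entries_cV _ diag_entry_inj); last exact: ge0_measurable_int_entries.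
  by apply: eq_integral => z _; rewrite (int_entries_cV _ edge_entry_inj).
rewrite (int_entries_perm F0 coord_entries_perm) int_entries_prod//.
- rewrite big_enum; apply: eq_bigr => i _.
  rewrite block_entriesE /=; apply: eq_integral => d _.
  rewrite int_entries_cV//; last exact: pa_entry_inj.
  apply: eq_integral => l _; congr g; congr pair.
    rewrite set_entries_out => [|k [ki]]; first by rewrite mxE /diag_entry eqxx.
    by have := enum_val_pa_neq k; rewrite ki eqxx.
  apply/matrixP => k h; rewrite mxE (ord1 h).
  by rewrite (set_entries_in _ _ (@pa_entry_inj i) (k := k)).
- exact: enum_uniq.
- move=> i j k ij /mapP[h _ ->] X t.
  have Xe a : set_entry X (h, j) t a i = X a i.
    by rewrite mxE; case: ifP => // /eqP[_ ji]; rewrite ji eqxx in ij.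
  rewrite /f Xe; congr (g i (_, _)).
  by apply/matrixP => a b; rewrite mxE Xe mxE.
Qed.

End chol_coordinates.

(** * Densities *)

Section integral_density.
Local Open Scope ereal_scope.
Context d (T : measurableType d) (R : realType).
Variables (mu nu : {measure set T -> \bar R}) (f : T -> R).
Hypothesis mf : measurable_fun setT f.
Hypothesis f0 : forall x, (0 <= f x)%R.
Hypothesis nuE : forall A, measurable A -> nu A = \int[mu]_(x in A) (f x)%:E.

Import HBNNSimple.

(** True for indicators by hypothesis, hence for simple functions, and in
    general by monotone convergence. *)
Lemma ge0_integral_density (g : T -> \bar R) A :
  measurable A -> measurable_fun A g -> (forall x, 0 <= g x) ->
  \int[nu]_(x in A) g x = \int[mu]_(x in A) (g x * (f x)%:E).
Proof.
move=> mA mg g0; have mf' : measurable_fun A (EFin \o f).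
  by apply: measurable_funTS; exact/measurable_EFinP.
pose h := nnsfun_approx mA mg.
have -> : \int[nu]_(x in A) g x =
    lim (\int[nu]_(x in A) (EFin \o h n) x @[n --> \oo]).
  have gE x : A x -> g x = lim ((EFin \o h n) x @[n --> \oo]).
    by move=> Ax; apply/esym/cvg_lim => //; exact: cvg_nnsfun_approx.
  under eq_integral => x /[!inE] /gE -> //.
  apply: monotone_convergence => //.
  - by move=> n; apply/measurable_EFinP; exact: measurable_funTS.
  - by move=> n x Ax //=; rewrite lee_fin.
  - by move=> x Ax a b ab; rewrite lee_fin; exact/lefP/nd_nnsfun_approx.
have -> : \int[mu]_(x in A) (g x * (f x)%:E) =
    lim (\int[mu]_(x in A) ((EFin \o h n) x * (f x)%:E) @[n --> \oo]).
  have gf x : A x ->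
      g x * (f x)%:E = lim (((EFin \o h n) x * (f x)%:E) @[n --> \oo]).
    by move=> Ax; apply/esym/cvg_lim => //; apply: cvgeZr => //;
      exact: cvg_nnsfun_approx.
  under eq_integral => x /[!inE] /gf -> //.
  apply: monotone_convergence => [//| | |].
  - move=> n; apply/emeasurable_funM => //; apply/measurable_funTS.
    exact/measurable_EFinP.
  - by move=> n x Ax /=; rewrite mule_ge0 ?lee_fin.
  - by move=> x Ax a b ab/=; rewrite lee_wpmul2r ?lee_fin//; exact/lefP/nd_nnsfun_approx.
suff suf n : \int[mu]_(x in A) ((EFin \o h n) x * (f x)%:E) =
    \int[nu]_(x in A) (EFin \o h n) x.
  by under [in RHS]eq_fun do rewrite suf.
transitivity (\int[nu]_(x in A)
   (\sum_(y \in range (h n)) (y * \1_(h n @^-1` [set y]) x)%:E)); last first.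
  by apply: eq_integral => t tA; rewrite /= fimfunE -fsumEFin.
have indich m r : measurable_fun A (fun x => (r * \1_(h m @^-1` [set r]) x)%:E).
  by apply: (measurable_comp measurableT) => //; exact: measurable_funM.
rewrite ge0_integral_fsum//; last by move=> m y Ay; exact: nnfun_muleindic_ge0.
transitivity (\int[mu]_(x in A) (\sum_(y \in range (h n))
    (y * \1_(h n @^-1` [set y]) x)%:E * (f x)%:E)).
  under [RHS]eq_integral => x xA.
    rewrite -ge0_mule_fsuml => [|y]; last exact: nnfun_muleindic_ge0.
    rewrite fsumEFin // -(fimfunE _ x); over.
  by [].
rewrite ge0_integral_fsum//; last 2 first.
  - by move=> y; apply: emeasurable_funM.
  - by move=> m y Ay; rewrite mule_ge0 ?lee_fin// -lee_fin nnfun_muleindic_ge0.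
apply: eq_fsbigr => r rhn.
under [RHS]eq_integral do rewrite EFinM.
rewrite integralZl_indic_nnsfun => //.
under eq_integral do rewrite EFinM -muleA.
rewrite ge0_integralZl//.
- under eq_integral do rewrite muleC.
  rewrite (eq_integral ((EFin \o f) \_ (h n @^-1` [set r]))); last first.
    by move=> x xA; rewrite epatch_indic.
  by rewrite -integral_mkcondr -nuE// integral_indic// setIC.
- by apply: emeasurable_funM => //; exact/measurable_EFinP.
- by move=> t At; rewrite mule_ge0 ?lee_fin.
- by move: rhn; rewrite inE => -[t _ <-]; rewrite lee_fin.
Qed.

End integral_density.

(** * The normal density *)

Section normal_law.
Context (R : realType) (n : nat).
Implicit Types (m : 'cV[R]_n) (A : 'M[R]_n).

(** At x = 0 both sides vanish, as a singular matrix is its own inverse by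
    convention and 0 inverts to 0; so the normal density is a measurable function
    of its scale on the whole line. *)
Lemma invmx_scale (x : R) A : A \in unitmx -> invmx (x *: A) = x^-1 *: invmx A.
Proof.
move=> uA; have [->|x0] := eqVneq x 0; last first.
  by rewrite invmxZ// unitmxZ// unitfE.
rewrite invr0 !scale0r; case: n A uA => [|k] A uA; first exact: flatmx0.
by rewrite invmx_out// inE unitmxE det0 unitr0.
Qed.

Lemma posdef_invmx A : posdefmx A -> posdefmx (invmx A).
Proof.
move=> pA; have [As A0] := pA.
have uA : A \in unitmx by rewrite unitmxE unitfE gt_eqF// posdef_det_gt0.
have Vs : (invmx A)^T = invmx A by rewrite trmx_inv As.
split=> // x x0; have y0 : invmx A *m x != 0.
  by apply: contra_neq x0 => h; rewrite -(mulKVmx uA x) h mulmx0.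
by have := A0 _ y0; rewrite trmx_mul Vs -!mulmxA (mulKVmx uA) mulmxA.
Qed.

Lemma posdef_scale (x : R) A : 0 < x -> posdefmx A -> posdefmx (x *: A).
Proof.
move=> x0 [As A0]; split=> [|y y0]; first by rewrite linearZ/= As.
by rewrite -scalemxAr -scalemxAl mxE mulr_gt0// A0.
Qed.

Lemma mvnormal_pdf_ge0 m A x : 0 <= mvnormal_pdf m A x.
Proof. by rewrite mulr_ge0 ?invr_ge0 ?sqrtr_ge0 ?expR_ge0. Qed.

Lemma mvnormal_pdfZ m A (t : R) x : A \in unitmx ->
  mvnormal_pdf m (t *: A) x =
  (Num.sqrt ((2 * pi) ^+ n * (t ^+ n * \det A)))^-1 *
  expR (- (t^-1 * qform (invmx A) (x - m) / 2)).
Proof.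
move=> uA; rewrite /mvnormal_pdf detZ invmx_scale//.
by rewrite -scalemxAr -scalemxAl mxE mulNr.
Qed.

Lemma measurable_mvnormal_pdf m A : A \in unitmx ->
  measurable_fun setT
    (fun z : R * 'cV[R]_n => mvnormal_pdf m (z.1 *: A) z.2).
Proof.
move=> uA; under eq_fun do rewrite mvnormal_pdfZ//.
have m1 : measurable_fun setT (fun z : R * 'cV[R]_n => z.1).
  exact: measurable_fst.
apply: measurable_funM.
  apply: (measurableT_comp (@measurable_inv R)).
  apply: (measurableT_comp (continuous_measurable_fun (@sqrt_continuous R))).
  apply: measurable_funM => //; apply: measurable_funM => //.
  exact: measurable_funX.
apply: measurableT_comp => //; apply: measurable_funN.
apply: measurable_funM => //; apply: measurable_funM.
  exact: measurableT_comp (@measurable_inv R) m1.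
by apply: measurable_qform; exact: measurable_snd.
Qed.

Lemma mvnormal_total m A : posdefmx A -> mvnormal m A setT = 1%E.
Proof.
move=> pA; have pV := posdef_invmx pA; have dA := posdef_det_gt0 pA.
rewrite /mvnormal; under eq_integral do rewrite EFinM mulNr -/(qform _ _).
rewrite ge0_integralZl_EFin//; last first.
  apply/measurable_EFinP; apply: measurableT_comp => //.
  apply: measurable_funN; apply: measurable_funM => //.
  exact: measurable_qform (@measurable_id _ _ _).
rewrite integral_gauss// det_inv invrK -EFinM mulVf// gt_eqF// sqrtr_gt0.
by rewrite mulr_gt0// exprn_gt0// mulr_gt0// pi_gt0.
Qed.

Lemma mvnormal_indic m A B : measurable B ->
  mvnormal m A B =
  (\int[lebesgue_cV R n]_x (mvnormal_pdf m A x * \1_B x)%:E)%E.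
Proof.
move=> mB; rewrite /mvnormal integral_mkcond epatch_indic.
by apply: eq_integral => x _; rewrite EFinM.
Qed.

Lemma measurable_mvnormal m A B : A \in unitmx -> measurable B ->
  measurable_fun setT (fun t : R => mvnormal m (t *: A) B).
Proof.
move=> uA mB; under eq_fun do rewrite mvnormal_indic//.
apply: (@measurable_fun_fubini_tonelli_F _ _ R _ R (lebesgue_cV R n)
  (fun z => (mvnormal_pdf m (z.1 *: A) z.2 * \1_B z.2)%:E)) => [|z].
  apply/measurable_EFinP; apply: measurable_funM.
    exact: measurable_mvnormal_pdf.
  by apply: measurableT_comp measurable_snd; exact: measurable_indic.
by rewrite lee_fin mulr_ge0 ?mvnormal_pdf_ge0.
Qed.

Lemma mvnormal_ge0 m A B : (0 <= mvnormal m A B)%E.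
Proof. by apply: integral_ge0 => x _; rewrite lee_fin mvnormal_pdf_ge0. Qed.

Lemma mvnormal_pdfN m A x : mvnormal_pdf (- m) A x = mvnormal_pdf m A (- x).
Proof.
rewrite /mvnormal_pdf (_ : - x - m = - (x - - m)); last first.
  by rewrite opprD opprK.
set y := x - - m.
by rewrite (linearN (@trmx _ _ _))/= mulNmx mulmxN mulNmx opprK.
Qed.

Lemma measurable_oppV (B : set 'cV[R]_n) :
  measurable B -> measurable ((fun x => - x) @^-1` B : set 'cV[R]_n).
Proof.
move=> mB; rewrite -[X in measurable X]setTI.
have mN : measurable_fun setT (fun x : 'cV[R]_n => - x).
  apply: measurable_fun_mxP => i j; under eq_fun do rewrite mxE.
  by apply: measurable_funN; exact: measurable_mx_entry.
exact: mN.
Qed.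

Lemma mvnormalN m A (B : set 'cV[R]_n) : measurable B ->
  mvnormal (- m) A ((fun x => - x) @^-1` B) = mvnormal m A B.
Proof.
move=> mB; have mN := measurable_oppV mB.
rewrite !mvnormal_indic// -[RHS]ge0_integral_cV_opp.
- by apply: eq_integral => x _; rewrite -mvnormal_pdfN !indicE.
- apply/measurable_EFinP; apply: measurable_funM.
    apply: measurable_funM => //; apply: measurableT_comp => //.
    apply: measurable_funM => //; apply: measurable_funN.
    exact: measurable_qform (@measurable_id _ _ _).
  exact: measurable_indic.
- by move=> x; rewrite lee_fin mulr_ge0 ?mvnormal_pdf_ge0.
Qed.

End normal_law.

(** * The block of one vertex *)

Section block_law.
Context (R : realType) (p : nat) (e : rel 'I_p) (U : 'M[R]_p).
Variable alpha : 'I_p -> R.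
Implicit Types (i j : 'I_p).
Hypothesis pU : posdefmx U.

Local Notation pdeg i := (#|pa e i|).

(** The part of the kernel that involves D_ii (first component) and column i of
    L (second component). *)
Definition block_kernel i (x : R * 'cV[R]_#|pa e i|) : R :=
  expR (- ((pa_schur e U i + qform (pa_mx e U i) (x.2 + reg_coef e U i)) /
           (2 * x.1))) * x.1 `^ (- (alpha i / 2)).

Lemma invmx_diag n (d : 'rV[R]_n) : (forall i : 'I_n, d ord0 i != 0) ->
  invmx (diag_mx d) = diag_mx (\row_(i < n) (d ord0 i)^-1).
Proof.
move=> d0; have dd : diag_mx d *m diag_mx (\row_(i < n) (d ord0 i)^-1) = 1%:M.
  apply/matrixP => i j; rewrite mul_diag_mx !mxE.
  by case: eqP => _; rewrite ?mulr0n ?mulr0// mulr1n divff.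
have [ud _] := mulmx1_unit dd.
by rewrite -[RHS](mulKmx ud) dd mulmx1.
Qed.

Lemma mxtrace_LDLU (d : 'rV[R]_p) (L : 'M[R]_p) : (forall i, d ord0 i != 0) ->
  \tr (L *m invmx (diag_mx d) *m L^T *m U) =
  \sum_i (d ord0 i)^-1 * qform U (col i L).
Proof.
move=> d0; rewrite invmx_diag// -!mulmxA mxtrace_mulC -!mulmxA.
rewrite /mxtrace; apply: eq_bigr => i _; rewrite mul_diag_mx mxE mxE.
congr (_ * _); rewrite mulmxA mxE [RHS]mxE; apply: eq_bigr => k _.
rewrite !mxE; congr (_ * _); apply: eq_bigr => h _; by rewrite !mxE.
Qed.

Lemma qform_col_LD (L : 'M[R]_p) i : LD e L ->
  qform U (col i L) = pa_schur e U i +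
    qform (pa_mx e U i) (pa_col e L i + reg_coef e U i).
Proof.
move=> [_ L1 L0]; rewrite (qform_pa_support pU (e := e) (i := i)); last first.
  by move=> j ji jp; rewrite mxE L0.
rewrite mxE L1 expr1n mul1r mulr1 -qform_complete_square//.
have -> : \col_(k < pdeg i) col i L (enum_val k) ord0 = pa_col e L i.
  by apply/matrixP => k h; rewrite !mxE.
by [].
Qed.

(** The trace is the sum over i of the quadratic form of U at column i of L,
    divided by D_ii. *)
Lemma chol_kernelE DL : ThetaD e DL ->
  chol_kernel U alpha DL =
  \prod_i block_kernel (DL.1 i i, pa_col e DL.2 i).
Proof.
case: DL => D L [/= /diag_mxP[d ->] d0 LL].
have d0' i : 0 < d ord0 i by have := d0 i; rewrite mxE eqxx mulr1n.
rewrite /block_kernel big_split/= mxtrace_LDLU => [|i]; last by rewrite gt_eqF.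
congr (_ * _); rewrite -expR_sum; congr expR.
rewrite mulr_suml -sumrN; apply: eq_bigr => i _; congr (- _).
rewrite qform_col_LD// !mxE eqxx mulr1n; field.
by rewrite gt_eqF.
Qed.

Definition ig_shape i : R := (alpha i - (pdeg i)%:R) / 2 - 1.

Definition block_scale i : R :=
  Num.sqrt ((2 * pi) ^+ pdeg i * \det (invmx (pa_mx e U i))).

Lemma block_scale_gt0 i : 0 < block_scale i.
Proof.
rewrite sqrtr_gt0 mulr_gt0 ?exprn_gt0 ?mulr_gt0 ?pi_gt0//.
by apply/posdef_det_gt0/posdef_invmx/posdef_pa_mx.
Qed.

Lemma pa_mx_unit i : pa_mx e U i \in unitmx.
Proof.
by rewrite unitmxE unitfE gt_eqF//; apply/posdef_det_gt0/posdef_pa_mx.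
Qed.

(** The normalization of the normal density in dimension pa_i supplies a power
    t ^ (pa_i / 2), which moves the exponent of t from - alpha_i / 2 to that of
    an inverse gamma density of shape (alpha_i - pa_i) / 2 - 1. *)
Lemma block_kernelE i t l : 0 < t ->
  block_kernel (t, l) = block_scale i *
    ig_kernel (ig_shape i) (pa_schur e U i / 2) t *
    mvnormal_pdf (- reg_coef e U i) (t *: invmx (pa_mx e U i)) l.
Proof.
move=> t0; rewrite mvnormal_pdfZ ?unitmx_inv ?pa_mx_unit// invmxK opprK.
set q := qform _ _; set s := pa_schur e U i.
have c0 : 0 < (2 * pi) ^+ pdeg i :> R by rewrite exprn_gt0// mulr_gt0// pi_gt0.
have V0 : 0 < \det (invmx (pa_mx e U i)).
  by apply/posdef_det_gt0/posdef_invmx/posdef_pa_mx.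
rewrite [X in Num.sqrt X]mulrCA sqrtrM ?exprn_ge0 ?(ltW t0)// -/(block_scale i).
have -> : Num.sqrt (t ^+ pdeg i) = t `^ ((pdeg i)%:R / 2).
  by rewrite powRrM powR_mulrn ?(ltW t0)// powR12_sqrt ?exprn_ge0 ?(ltW t0).
rewrite /block_kernel /= -/q /ig_kernel.
have -> : - ((s + q) / (2 * t)) = - (s / 2 / t) + - (t^-1 * q / 2).
  by field; rewrite gt_eqF.
rewrite expRD.
have -> : - ig_shape i - 1 = (pdeg i)%:R / 2 + - (alpha i / 2).
  by rewrite /ig_shape; field.
rewrite powRD ?(gt_eqF t0) ?implybT//; field.
by rewrite !gt_eqF ?powR_gt0 ?block_scale_gt0.
Qed.

Lemma block_kernel_ge0 i x : 0 <= block_kernel (i := i) x.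
Proof. by rewrite mulr_ge0 ?expR_ge0 ?powR_ge0. Qed.

Lemma measurable_block_kernel i : measurable_fun setT (@block_kernel i).
Proof.
have m1 : measurable_fun setT (fun x : R * 'cV[R]_#|pa e i| => x.1).
  exact: measurable_fst.
apply: measurable_funM; last first.
  exact: measurableT_comp (@measurable_powR R _) m1.
apply: measurableT_comp => //; apply: measurable_funN; apply: measurable_funM.
  apply: measurable_funD => //; under eq_fun do rewrite -[reg_coef _ _ _]opprK.
  by apply: measurable_qform; exact: measurable_snd.
apply: measurableT_comp (@measurable_inv R) _.
exact: measurable_funM.
Qed.

Definition pos_block i : set (R * 'cV[R]_#|pa e i|) := [set x | 0 < x.1].

Lemma measurable_pos_block i : measurable (@pos_block i).
Proof.
have -> : @pos_block i = fst @^-1` `]0, +oo[%classic.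
  by apply/seteqP; split=> x; rewrite /pos_block /= in_itv/= andbT.
by rewrite -[X in measurable X]setTI; apply: measurable_fst.
Qed.

Definition block_integral i (A : set (R * 'cV[R]_#|pa e i|)) : \bar R :=
  (\int[lebesgue_measure]_t \int[lebesgue_cV R #|pa e i|]_l
    (block_kernel (t, l) * \1_(A `&` @pos_block i) (t, l))%:E)%E.

(** Given t, the integral over the column of L is a normal probability up to a
    factor that depends on t only. *)
Lemma block_integralX i (A : set R) (B : set 'cV[R]_#|pa e i|) :
  measurable A -> measurable B ->
  block_integral (A `*` B) = ((block_scale i)%:E *
    \int[lebesgue_measure]_(t in A `&` `]0%R, +oo[)
      ((ig_kernel (ig_shape i) (pa_schur e U i / 2) t)%:E *
       mvnormal (- reg_coef e U i) (t *: invmx (pa_mx e U i)) B))%E.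
Proof.
move=> mA mB; have mAp : measurable (A `&` `]0, +oo[%classic) by exact: measurableI.
have mk D : measurable_fun D
    (fun t => (ig_kernel (ig_shape i) (pa_schur e U i / 2) t)%:E).
  by apply: measurable_funTS; apply/measurable_EFinP; exact: measurable_ig_kernel.
have mn D : measurable_fun D
    (fun t : R => mvnormal (- reg_coef e U i) (t *: invmx (pa_mx e U i)) B).
  apply: measurable_funTS; apply: measurable_mvnormal => //.
  by rewrite unitmx_inv pa_mx_unit.
rewrite -ge0_integralZl_EFin//; last 3 first.
- by move=> t _; rewrite mule_ge0 ?mvnormal_ge0// lee_fin ig_kernel_ge0.
- by apply: emeasurable_funM; [exact: mk|exact: mn].
- exact/ltW/block_scale_gt0.
rewrite /block_integral [RHS]integral_mkcond; apply: eq_integral => t _.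
rewrite epatch_indic/=; have [tA|tA] := pselect ((A `&` `]0, +oo[%classic) t).
  rewrite indicE mem_set// mule1 mvnormal_indic// muleA -EFinM.
  have [tA1] := tA; rewrite /= in_itv/= andbT => t0.
  rewrite -ge0_integralZl_EFin//; last 3 first.
  - by move=> l _; rewrite lee_fin mulr_ge0 ?mvnormal_pdf_ge0.
  - apply/measurable_EFinP; apply: measurable_funM; last exact: measurable_indic.
    have := @measurable_mvnormal_pdf R _ (- reg_coef e U i) (invmx (pa_mx e U i)).
    rewrite unitmx_inv pa_mx_unit => /(_ isT).
    exact: measurable_fun_pair2.
  - by rewrite mulr_ge0 ?ig_kernel_ge0// ltW// block_scale_gt0.
  apply: eq_integral => l _; rewrite block_kernelE// -EFinM -!mulrA.
  have -> : \1_(A `*` B `&` @pos_block i) (t, l) = \1_B l :> R.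
    rewrite !indicE; have [lB|lB] := pselect (B l).
      by rewrite !mem_set.
    by rewrite !memNset// => -[[]].
  by [].
rewrite indicE memNset// mule0 integral0_eq// => l _.
rewrite indicE memNset ?mulr0// => -[[/= h1 _] h2]; apply: tA; split=> //.
by rewrite /= in_itv/= andbT.
Qed.

End block_law.

(** * The law of the Cholesky parameters *)

Lemma measurable_forall d (T : measurableType d) (I : finType)
    (P : I -> set T) :
  (forall i, measurable (P i)) -> measurable [set x | forall i, P i x].
Proof.
move=> mP; have -> : [set x | forall i, P i x] = \bigcap_(i in [set: I]) P i.
  by apply/seteqP; split=> [x Px i _|x Px i]; exact: Px.
exact: fin_bigcap_measurable.
Qed.

Lemma prode_gt0_lty (R : realType) (I : eqType) (r : seq I) (f : I -> \bar R) :
  (forall i, (0 < f i)%E) ->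
  (\prod_(i <- r) f i < +oo)%E <-> (forall i, i \in r -> (f i < +oo)%E).
Proof.
move=> f0; elim: r => [|i r IH]; first by rewrite big_nil ltry; split.
have p0 : (0 < \prod_(j <- r) f j)%E.
  clear IH; elim: r => [|j r IH]; rewrite ?big_nil ?lte_fin//.
  by rewrite big_cons mule_gt0.
rewrite big_cons; split=> [h j|h].
  have fi : (f i < +oo)%E.
    by case: (f i) (f0 i) h => [a _ _|_|]//; rewrite ?ltry ?gt0_mulye.
  rewrite inE => /orP[/eqP ->//|]; apply: (IH.1 _ j).
  by case: (\prod_(j <- r) f j)%E p0 h => [a _ _|_|]//;
    rewrite ?ltry ?gt0_muley.
apply: lte_mul_pinfty; first exact: ltW.
  by rewrite ge0_fin_numE ?ltW// h// inE eqxx.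
by apply: IH.2 => j jr; apply: h; rewrite inE jr orbT.
Qed.

Section chol_law_blocks.
Context (R : realType) (p : nat) (e : rel 'I_p) (U : 'M[R]_p).
Variable alpha : 'I_p -> R.
Implicit Types (i j : 'I_p).
Hypothesis pU : posdefmx U.
Hypothesis po : parent_ordered e.

Local Notation ig_rate i := (pa_schur e U i / 2).
Local Notation block i := (R * 'cV[R]_#|pa e i|)%type.

(** It is the value of the quadratic form of U at the vector that is 1 at i and
    minus the regression coefficients on the parents of i. *)
Lemma pa_schur_gt0 i : 0 < pa_schur e U i.
Proof.
pose l := - reg_coef e U i.
pose y : 'cV[R]_p := \col_j (if j == i then 1 else
  if [pick k : 'I_#|pa e i| | enum_val k == j] is Some k then l k ord0 else 0).
have yx k : y (enum_val k) ord0 = l k ord0.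
  rewrite mxE enum_val_pa_neq; case: pickP => [h /eqP/enum_val_inj -> //|/(_ k)].
  by rewrite eqxx.
have yi : y i ord0 = 1 by rewrite mxE eqxx.
have [_ U0] := pU; have /U0 : y != 0.
  by apply/eqP => /matrixP/(_ i ord0); rewrite yi mxE; apply/eqP/oner_neq0.
rewrite -/(qform _ _) (qform_pa_support pU (e := e) (i := i)); last first.
  move=> j ji jp; rewrite mxE (negbTE ji); case: pickP => // k /eqP kj.
  by have := enum_valP k; rewrite kj (negbTE jp).
have -> : \col_(k < #|pa e i|) y (enum_val k) ord0 = l.
  by apply/matrixP => k h; rewrite (ord1 h) mxE yx.
rewrite yi expr1n mul1r mulr1 qform_complete_square// addNr.
by rewrite /qform mulmx0 mxE addr0.
Qed.

Lemma ig_rate_gt0 i : 0 < ig_rate i.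
Proof. by rewrite divr_gt0// pa_schur_gt0. Qed.

Lemma measurable_fiber d (T : measurableType d) (f : T -> R) (a : R) :
  measurable_fun setT f -> measurable [set x | f x = a].
Proof.
move=> mf; have -> : [set x | f x = a] = f @^-1` [set a] by [].
by rewrite -[X in measurable X]setTI; apply: mf.
Qed.

Let mD i j :
  measurable_fun setT (fun DL : 'M[R]_p * 'M[R]_p => DL.1 i j).
Proof.
apply: (measurableT_comp (f := fun X : 'M[R]_p => X i j)) => //.
exact: measurable_mx_entry.
Qed.

Let mL i j :
  measurable_fun setT (fun DL : 'M[R]_p * 'M[R]_p => DL.2 i j).
Proof.
apply: (measurableT_comp (f := fun X : 'M[R]_p => X i j)) => //.
exact: measurable_mx_entry.
Qed.

Definition chol_block i (DL : 'M[R]_p * 'M[R]_p) : R * 'cV[R]_#|pa e i| :=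
  (DL.1 i i, pa_col e DL.2 i).

Lemma measurable_chol_block i : measurable_fun setT (chol_block i).
Proof.
apply/measurable_fun_pair; first exact: mD.
by apply: measurable_pa_col; exact: measurable_snd.
Qed.

Lemma measurable_ThetaD : measurable (@ThetaD R p e).
Proof.
pose P (ij : 'I_p * 'I_p) : set ('M[R]_p * 'M[R]_p) :=
  [set DL : 'M[R]_p * 'M[R]_p | [/\ ij.1 != ij.2 -> DL.1 ij.1 ij.2 = 0,
    0 < DL.1 ij.1 ij.1, DL.2 ij.1 ij.1 = 1 &
    (ij.1 < ij.2)%N || ((ij.1 != ij.2) && (ij.1 \notin pa e ij.2)) ->
    DL.2 ij.1 ij.2 = 0]].
have -> : @ThetaD R p e = [set DL | forall ij, P ij DL].
  apply/seteqP; split=> [[D L] [/= /is_diag_mxP D0 D1 [L0 L1 L2]] [i j]|].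
    split=> //=; first exact: D0.
    by move=> /orP[/L0//|/andP[ij ijp]]; exact: L2.
  move=> [D L] H; split=> /=.
  - by apply/is_diag_mxP => i j; have [] := H (i, j).
  - by move=> i; have [] := H (i, i).
  - split=> [i j ij|i|i j ij ijp].
    + by have [_ _ _] := H (i, j); apply; rewrite /= ij.
    + by have [] := H (i, i).
    + by have [_ _ _] := H (i, j); apply; rewrite /= ij ijp orbT.
apply: measurable_forall => -[i j].
have imp (b : bool) (f : 'M[R]_p * 'M[R]_p -> R) a : measurable_fun setT f ->
    measurable [set x | b -> f x = a].
  case: b => mf.
    rewrite (_ : [set x | _] = [set x | f x = a]); first exact: measurable_fiber.
    by apply/seteqP; split=> x /=; [exact|].
  by rewrite (_ : [set x | _] = setT)//; apply/seteqP; split.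
rewrite (_ : P (i, j) = [set x : 'M[R]_p * 'M[R]_p | i != j -> x.1 i j = 0] `&`
  ((fun x : 'M[R]_p * 'M[R]_p => x.1 i i) @^-1` `]0, +oo[%classic `&`
   ([set x : 'M[R]_p * 'M[R]_p | x.2 i i = 1] `&`
    [set x : 'M[R]_p * 'M[R]_p |
      (i < j)%N || ((i != j) && (i \notin pa e j)) -> x.2 i j = 0]))).
  apply: measurableI; first exact: imp (mD i j).
  apply: measurableI.
    by rewrite -[X in measurable X]setTI; apply: mD.
  by apply: measurableI; [exact: measurable_fiber (mL i i)|exact: imp (mL i j)].
apply/seteqP; split=> x.
  by move=> [/= h1 h2 h3 h4]; split=> //; split=> //=; rewrite in_itv/= h2.
by move=> [/= h1 [/=]]; rewrite in_itv/= andbT => h2 [h3 h4]; split=> /=.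
Qed.

Definition cyl (A : forall i, set (R * 'cV[R]_#|pa e i|)) :
  set ('M[R]_p * 'M[R]_p) := [set DL | forall i, A i (chol_block i DL)].

Lemma measurable_cyl A : (forall i, measurable (A i)) -> measurable (cyl A).
Proof.
move=> mA; apply: (@measurable_forall _ _ _ (fun i => chol_block i @^-1` A i)) => i.
by rewrite -[X in measurable X]setTI; apply: measurable_chol_block; last exact: mA.
Qed.

Lemma chol_kernel_ge0 DL : 0 <= chol_kernel U alpha DL.
Proof.
case: DL => D L; rewrite mulr_ge0 ?expR_ge0//.
by apply: prodr_ge0 => i _; exact: powR_ge0.
Qed.

Lemma measurable_chol_kernel : measurable_fun (@ThetaD R p e) (chol_kernel U alpha).
Proof.
pose F DL := \prod_i block_kernel U alpha (chol_block i DL).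
apply: (@eq_measurable_fun _ _ _ _ _ F).
  by move=> DL; rewrite inE => DLT; rewrite (chol_kernelE _ pU DLT).
apply: measurable_funTS; rewrite /F.
elim: (index_enum _) => [|i r IH].
  by under eq_fun do rewrite big_nil; exact: measurable_cst.
under eq_fun do rewrite big_cons; apply: measurable_funM => //.
apply: (measurableT_comp (f := @block_kernel R p e U alpha i)).
  exact: measurable_block_kernel.
exact: measurable_chol_block.
Qed.

(** Restricting to a product of block events restricts each factor, so the
    factorization gives both the total mass and the independence. *)
Lemma integral_chol_kernel_cyl A : (forall i, measurable (A i)) ->
  (\int[chol_measure e]_(DL in cyl A `&` @ThetaD R p e) (chol_kernel U alpha DL)%:E =
   \prod_i block_integral U alpha (A i))%E.
Proof.
move=> mA; have mT := measurable_ThetaD; have mc := measurable_cyl mA.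
rewrite (ge0_integral_pushforward (@measurable_chol_coord R p e)); last 3 first.
- exact: measurableI.
- apply/measurable_EFinP; apply: measurable_funS measurable_chol_kernel => //.
- by move=> DL _; rewrite lee_fin chol_kernel_ge0.
pose g i x : \bar R :=
  (block_kernel U alpha x * \1_(A i `&` @pos_block R p e i) x)%:E.
have mg i : measurable_fun setT (g i).
  apply/measurable_EFinP; apply: measurable_funM.
    exact: measurable_block_kernel.
  by apply: measurable_indic; apply: measurableI;
    [exact: mA|exact: measurable_pos_block].
have g0 i x : (0 <= g i x)%E by rewrite lee_fin mulr_ge0// block_kernel_ge0.
rewrite -(ge0_integral_chol_coord mg g0) integral_mkcond.
apply: eq_integral => z _; rewrite epatch_indic /comp indicE.
have [[zA zT]|zN] := pselect ((@chol_coord R p e @^-1` (cyl A `&` @ThetaD R p e)) z).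
  rewrite mem_set// mule1 (chol_kernelE _ pU zT) -prodEFin.
  apply: eq_bigr => i _; rewrite /g indicE mem_set ?mulr1//; split.
    exact: (zA i).
  by case: zT => _ z0 _; exact: z0.
rewrite memNset// mule0.
have [i iN] : exists i, ~ (A i `&` @pos_block R p e i) (chol_block i (chol_coord z)).
  apply/existsNP => H; apply: zN; split=> [i|]; first by have [] := H i.
  by apply/(chol_coord_ThetaD z po) => i; rewrite -chol_coord_D; have [] := H i.
by rewrite (bigD1 i)//= /g indicE memNset// mulr0 mul0e.
Qed.

Lemma block_integralT i : block_integral U alpha (setT : set (block i)) =
  ((block_scale e U i)%:E * ig_integral (ig_shape e alpha i) (ig_rate i))%E.
Proof.
rewrite -setXTT block_integralX// setTI; congr (_ * _)%E.
apply: eq_integral => t; rewrite inE/= in_itv/= andbT => t0.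
rewrite mvnormal_total ?mule1//.
by apply: posdef_scale => //; apply/posdef_invmx/posdef_pa_mx.
Qed.

Lemma cylT : cyl (fun=> setT) = setT.
Proof. by apply/seteqP; split. Qed.

Lemma ig_shape_gt0 i : (0 < ig_shape e alpha i) = (#|pa e i|%:R + 2 < alpha i).
Proof.
by rewrite /ig_shape subr_gt0 ltr_pdivlMr// mul1r ltrBrDl.
Qed.

Lemma block_integralT_gt0 i : (0 < block_integral U alpha (setT : set (block i)))%E.
Proof.
rewrite block_integralT mule_gt0// ?lte_fin ?block_scale_gt0//.
have [a0|a0] := ltP 0 (ig_shape e alpha i).
  by rewrite ig_integral_gt0// ig_rate_gt0.
by rewrite ig_integral_pinfty// ig_rate_gt0.
Qed.

(** The integrability criterion for one block: the normal factor integrates to 1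
    and leaves an inverse gamma integral. *)
Lemma block_integralT_lty i :
  (block_integral U alpha (setT : set (block i)) < +oo)%E =
  (#|pa e i|%:R + 2 < alpha i).
Proof.
rewrite block_integralT -ig_shape_gt0; have c0 := block_scale_gt0 e pU i.
have [a0|a0] := ltP 0 (ig_shape e alpha i).
  by rewrite ig_integralE ?ig_rate_gt0// -EFinM ltry.
by rewrite ig_integral_pinfty ?ig_rate_gt0// gt0_muley ?ltxx ?lte_fin.
Qed.

(** A product of positive extended reals is finite only if each factor is. *)
Lemma chol_kernel_integrable :
  (chol_measure e).-integrable (@ThetaD R p e) (EFin \o chol_kernel U alpha) <->
  (forall i, #|pa e i|%:R + 2 < alpha i).
Proof.
have IE : (\int[chol_measure e]_(DL in @ThetaD R p e) (chol_kernel U alpha DL)%:E =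
    \prod_(i <- index_enum 'I_p) block_integral U alpha (setT : set (block i)))%E.
  by rewrite -integral_chol_kernel_cyl// cylT setTI.
have LE := prode_gt0_lty (index_enum 'I_p) block_integralT_gt0.
have absE : (\int[chol_measure e]_(DL in @ThetaD R p e)
      `|(EFin \o chol_kernel U alpha) DL| =
    \int[chol_measure e]_(DL in @ThetaD R p e) (chol_kernel U alpha DL)%:E)%E.
  by apply: eq_integral => DL _ /=; rewrite ger0_norm// chol_kernel_ge0.
split=> [/integrableP[_]|h].
  by rewrite absE IE => /LE h i; rewrite -block_integralT_lty h// mem_index_enum.
apply/integrableP; split; first by apply/measurable_EFinP; exact: measurable_chol_kernel.
by rewrite absE IE; apply/LE => i _; rewrite block_integralT_lty.
Qed.

End chol_law_blocks.

(** * The normalized law *)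

Section chol_law_probability.
Context (R : realType) (p : nat) (e : rel 'I_p) (U : 'M[R]_p).
Variable alpha : 'I_p -> R.
Implicit Types (i j : 'I_p).
Hypothesis pU : posdefmx U.
Hypothesis po : parent_ordered e.
Hypothesis alpha_gt : forall i, #|pa e i|%:R + 2 < alpha i.

Local Notation ig_rate i := (pa_schur e U i / 2).
Local Notation shape i := (ig_shape e alpha i).
Local Notation block i := (R * 'cV[R]_#|pa e i|)%type.

Let shape_gt0 i : 0 < shape i.
Proof. by rewrite ig_shape_gt0. Qed.

(** The factor of the normalizing constant that belongs to vertex i. *)
Definition block_mass i : R :=
  block_scale e U i * (Gamma (shape i) / ig_rate i `^ shape i).

Lemma block_mass_gt0 i : 0 < block_mass i.
Proof.
rewrite mulr_gt0 ?block_scale_gt0// divr_gt0 ?powR_gt0 ?ig_rate_gt0//.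
by have [] := Gamma_integral (shape_gt0 i).
Qed.

Lemma block_massE i :
  block_integral U alpha (setT : set (block i)) = (block_mass i)%:E.
Proof. by rewrite block_integralT// ig_integralE ?ig_rate_gt0// -EFinM. Qed.

Lemma chol_constE : chol_const e U alpha = \prod_i block_mass i.
Proof.
have IE := integral_chol_kernel_cyl alpha pU po (fun i => @measurableT _ (block i)).
move: IE; rewrite cylT setTI => IE.
rewrite /chol_const /Rintegral IE (eq_bigr (fun i => (block_mass i)%:E)).
  by rewrite prodEFin.
by move=> i _; exact: block_massE.
Qed.

Definition block_prob i (A : set (block i)) : \bar R :=
  ((block_mass i)^-1%:E * block_integral U alpha A)%E.

Lemma block_probT i : block_prob (setT : set (block i)) = 1%E.
Proof.
by rewrite /block_prob block_massE -EFinM mulVf// gt_eqF// block_mass_gt0.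
Qed.

Lemma chol_law_cyl (A : forall i, set (block i)) :
  (forall i, measurable (A i)) ->
  chol_law e U alpha (cyl A) = (\prod_i block_prob (A i))%E.
Proof.
move=> mA; rewrite /chol_law.
have cV0 : 0 <= (chol_const e U alpha)^-1.
  by rewrite invr_ge0 chol_constE; apply: prodr_ge0 => i _; exact/ltW/block_mass_gt0.
under eq_integral do rewrite mulrC EFinM.
rewrite ge0_integralZl_EFin//; last 3 first.
- by apply: measurableI; [exact: measurable_cyl|exact: measurable_ThetaD].
- by move=> DL _; rewrite lee_fin chol_kernel_ge0.
- apply/measurable_EFinP; apply: measurable_funS (measurable_chol_kernel alpha pU) => //.
  exact: measurable_ThetaD.
rewrite (integral_chol_kernel_cyl alpha pU po mA) chol_constE -prodfV -prodEFin.
by rewrite -big_split.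
Qed.

Lemma block_probX i (A : set R) (B : set 'cV[R]_#|pa e i|) :
  measurable A -> measurable B ->
  block_prob (A `*` B) = (\int[lebesgue_measure]_(t in A)
    (mvnormal (- reg_coef e U i) (t *: invmx (pa_mx e U i)) B *
     (inverse_gamma_pdf (shape i) (ig_rate i) t)%:E))%E.
Proof.
move=> mA mB; rewrite /block_prob block_integralX// muleA -EFinM.
set k := (_ * block_scale _ _ _)%R.
have kE : k = ig_rate i `^ shape i / Gamma (shape i).
  rewrite /k /block_mass invfM mulrAC mulVf ?mul1r ?invf_div//.
  by rewrite gt_eqF// block_scale_gt0.
have [_ G0] := Gamma_integral (shape_gt0 i).
have k0 : 0 <= k by rewrite kE divr_ge0 ?powR_ge0// ltW.
rewrite -ge0_integralZl_EFin//; last 3 first.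
- exact: measurableI.
- by move=> t _; rewrite mule_ge0 ?mvnormal_ge0// lee_fin ig_kernel_ge0.
- apply: emeasurable_funM; apply: measurable_funTS.
    by apply/measurable_EFinP; exact: measurable_ig_kernel.
  by apply: measurable_mvnormal => //; rewrite unitmx_inv pa_mx_unit.
rewrite integral_mkcondr; apply: eq_integral => t _.
rewrite epatch_indic/= indicE /inverse_gamma_pdf.
have [t0|t0] := ltP 0 t.
  rewrite mem_set ?mule1; last by rewrite /= in_itv/= t0.
  by rewrite muleA -EFinM muleC kE mulrA.
by rewrite memNset ?mule0// /= in_itv/= andbT; apply/negP; rewrite -leNgt.
Qed.

Lemma inverse_gamma_pdf_ge0 i t :
  0 <= inverse_gamma_pdf (shape i) (ig_rate i) t.
Proof.
have [_ /ltW G0] := Gamma_integral (shape_gt0 i).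
rewrite /inverse_gamma_pdf; case: ifP => // _.
by rewrite mulr_ge0 ?expR_ge0// mulr_ge0 ?powR_ge0// divr_ge0 ?powR_ge0.
Qed.

Lemma measurable_inverse_gamma_pdf i :
  measurable_fun setT (inverse_gamma_pdf (shape i) (ig_rate i)).
Proof.
rewrite (_ : inverse_gamma_pdf _ _ = (fun t => \1_`]0, +oo[%classic t *
    (ig_rate i `^ shape i / Gamma (shape i) *
     ig_kernel (shape i) (ig_rate i) t))).
  apply: measurable_funM; first by apply: measurable_indic.
  by apply: measurable_funM => //; exact: measurable_ig_kernel.
apply/funext => t; rewrite /inverse_gamma_pdf indicE.
have [t0|t0] := ltP 0 t.
  by rewrite mem_set ?mul1r ?mulrA// /= in_itv/= t0.
rewrite memNset ?mul0r// /= in_itv/= andbT; apply/negP; by rewrite -leNgt.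
Qed.

Section random_parameters.
Context d (Omega : measurableType d) (P : probability Omega R).
Variable DL : {RV P >-> ('M[R]_p * 'M[R]_p)%type}.
Hypothesis lawDL : has_law P DL (chol_law e U alpha).

Lemma prob_cyl (A : forall i, set (block i)) : (forall i, measurable (A i)) ->
  P [set w | forall i, A i (chol_block e i (DL w))] =
  (\prod_i block_prob (A i))%E.
Proof. by move=> mA; rewrite -chol_law_cyl// -lawDL//; exact: measurable_cyl. Qed.

(** The marginal law of one block: impose nothing on the others. *)
Lemma prob_block i (A : set (block i)) : measurable A ->
  P [set w | A (chol_block e i (DL w))] = block_prob A.
Proof.
move=> mA; pose F := @dfwith 'I_p (fun j => set (block j)) (fun=> setT) i A.
have Fi : F i = A by exact: dfwith_in.
have Fj j : i != j -> F j = setT by move=> ij; exact: dfwith_out.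
transitivity (P [set w | forall j, F j (chol_block e j (DL w))]).
  congr (P _); apply/seteqP; split=> w /=; last by move=> /(_ i); rewrite Fi.
  move=> wA j; have [ij|ij] := eqVneq i j; last by rewrite Fj.
  by move: wA; rewrite -Fi; case: j / ij.
rewrite prob_cyl => [|j]; last first.
  by have [ij|ij] := eqVneq i j; [case: j / ij; rewrite Fi|rewrite Fj].
rewrite (bigD1 i)//= Fi big1 ?mule1// => j ji.
by rewrite Fj 1?eq_sym// block_probT.
Qed.

Let Dd i (w : Omega) : R := (DL w).1 i i.
Let ell i (w : Omega) : 'cV[R]_#|pa e i| := pa_col e (DL w).2 i.
Let beta i (w : Omega) : 'cV[R]_#|pa e i| := - ell i w.

(** Events on (D_ii, beta_i), read as events on (D_ii, l_i). *)
Definition flip i (A : set (block i)) : set (block i) :=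
  [set x | A (x.1, - x.2)].

Lemma measurable_flip i (A : set (block i)) : measurable A -> measurable (flip A).
Proof.
move=> mA; rewrite -[X in measurable X]setTI.
have mf : measurable_fun setT (fun x : block i => (x.1, - x.2)).
  apply/measurable_fun_pair; first exact: measurable_fst.
  apply: measurable_fun_mxP => k l; under eq_fun do rewrite mxE.
  apply: measurable_funN.
  apply: (measurableT_comp (f := fun X : 'cV[R]_#|pa e i| => X k l)) => //.
  exact: measurable_mx_entry.
exact: mf.
Qed.

Lemma independent_blocks :
  mutually_independent P (T := fun i => (R * 'cV[R]_#|pa e i|)%type)
    (fun i w => (Dd i w, beta i w)).
Proof.
move=> J A mA.
pose B i : set (block i) := if i \in J then flip (A i) else setT.
have mB i : measurable (B i).
  by rewrite /B; case: ifP => // iJ; apply: measurable_flip; exact: mA.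
have -> : \bigcap_(i in [set` J]) ((fun w => (Dd i w, beta i w)) @^-1` A i) =
    [set w | forall i, B i (chol_block e i (DL w))].
  apply/seteqP; split=> w /= h i; rewrite /B.
    by case: ifP => // iJ; exact: (h i iJ).
  by move=> /= iJ; have := h i; rewrite /B iJ.
rewrite prob_cyl// [RHS]big_mkcond/=; apply: eq_bigr => i _; rewrite /B.
case: ifP => iJ; last exact: block_probT.
by rewrite -prob_block//; apply: measurable_flip; exact: mA.
Qed.

Lemma law_D i : has_law P (Dd i) (inverse_gamma (shape i) (ig_rate i)).
Proof.
move=> A mA.
have -> : Dd i @^-1` A = [set w | (A `*` setT) (chol_block e i (DL w))].
  by apply/seteqP; split=> w /= => [|[]].
rewrite prob_block; last exact: measurableX.
rewrite block_probX//; apply: eq_integral => t _.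
have [t0|t0] := ltP 0 t.
  rewrite mvnormal_total ?mul1e//.
  by apply: posdef_scale => //; apply/posdef_invmx/posdef_pa_mx.
by rewrite /inverse_gamma_pdf ltNge t0/= mule0.
Qed.

Lemma measurable_Dd i : measurable_fun setT (Dd i).
Proof.
apply: (measurableT_comp (f := fun X : 'M[R]_p * 'M[R]_p => X.1 i i)) => //.
apply: (measurableT_comp (f := fun X : 'M[R]_p => X i i)) => //.
exact: measurable_mx_entry.
Qed.

Lemma ge0_integral_law_D i (g : R -> \bar R) A :
  measurable A -> measurable_fun A g -> (forall x, (0 <= g x)%E) ->
  (\int[pushforward P (Dd i)]_(x in A) g x =
   \int[lebesgue_measure]_(x in A)
     (g x * (inverse_gamma_pdf (shape i) (ig_rate i) x)%:E))%E.
Proof.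
move=> mA mg g0.
(* R carries its Borel sets under two displays; the integral over Omega, which
   mentions neither, passes from one to the other *)
transitivity (\int[P]_(w in Dd i @^-1` A) (g \o Dd i) w)%E.
  exact: (ge0_integral_pushforward (measurable_Dd i) P mA mg).
transitivity (\int[@pushforward _ _ _ (measurableTypeR R) R P (Dd i)]_(x in A)
    g x)%E.
  exact/esym/(@ge0_integral_pushforward _ _ _ (measurableTypeR R) _ _
    (measurable_Dd i) P A g mA mg).
pose nu : {measure set (measurableTypeR R) -> \bar R} :=
  @measure_function_pushforward__canonical__measure_function_Measure
    _ _ _ (measurableTypeR R) R P (Dd i) (measurable_Dd i).
exact: (@ge0_integral_density _ (measurableTypeR R) R lebesgue_measure nu _
  (measurable_inverse_gamma_pdf i) (inverse_gamma_pdf_ge0 i) (@law_D i) g A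
  mA mg g0).
Qed.

Lemma cond_law_ell i : has_cond_law P (Dd i) (ell i)
  (fun x => mvnormal (- reg_coef e U i) (x *: invmx (pa_mx e U i))).
Proof.
have uV : invmx (pa_mx e U i) \in unitmx by rewrite unitmx_inv pa_mx_unit.
split=> [B mB|A B mA mB]; first exact: measurable_mvnormal.
have -> : Dd i @^-1` A `&` ell i @^-1` B =
    [set w | (A `*` B) (chol_block e i (DL w))] by [].
rewrite prob_block; last exact: measurableX.
rewrite block_probX// ge0_integral_law_D//.
  by apply: measurable_funTS; exact: measurable_mvnormal.
by move=> x; exact: mvnormal_ge0.
Qed.

Lemma cond_law_beta i : has_cond_law P (Dd i) (beta i)
  (fun x => mvnormal (reg_coef e U i) (x *: invmx (pa_mx e U i))).
Proof.
have uV : invmx (pa_mx e U i) \in unitmx by rewrite unitmx_inv pa_mx_unit.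
split=> [B mB|A B mA mB]; first exact: measurable_mvnormal.
have [_ H] := cond_law_ell i.
apply: (etrans (H A ((fun x => - x) @^-1` B) mA (measurable_oppV mB))).
have E : (fun x => mvnormal (- reg_coef e U i) (x *: invmx (pa_mx e U i))
      ((fun y => - y) @^-1` B)) =
    (fun x => mvnormal (reg_coef e U i) (x *: invmx (pa_mx e U i)) B).
  by apply/funext => x; exact: mvnormalN.
exact: (congr1 (fun F => integral (pushforward P (Dd i)) A F) E).
Qed.

End random_parameters.

End chol_law_probability.

Theorem proposition3p2 (R : realType) (p : nat) (e : rel 'I_p)
    (U : 'M[R]_p) (alpha : 'I_p -> R) :
  parent_ordered e -> posdefmx U ->
  ((chol_measure e).-integrable (ThetaD e) (EFin \o chol_kernel U alpha) <->
   (forall i, (#|pa e i|)%:R + 2 < alpha i)) /\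
  ((forall i, (#|pa e i|)%:R + 2 < alpha i) ->
   chol_law e U alpha [set: _] = 1%E /\
   forall (d : measure_display) (Omega : measurableType d)
     (P : probability Omega R)
     (DL : {RV P >-> ('M[R]_p * 'M[R]_p)%type}),
     has_law P DL (chol_law e U alpha) ->
     let Dd i (w : Omega) : R := (DL w).1 i i in
     let ell i (w : Omega) : 'cV[R]_#|pa e i| := pa_col e (DL w).2 i in
     let beta i (w : Omega) : 'cV[R]_#|pa e i| := - ell i w in
     let a i : R := (alpha i - (#|pa e i|)%:R) / 2 - 1 in
     let UpaV i := invmx (pa_mx e U i) in
     [/\ mutually_independent P
           (T := fun i => (R * 'cV[R]_#|pa e i|)%type)
           (fun i w => (Dd i w, beta i w)),
         forall i, has_law P (Dd i)
           (inverse_gamma (a i) (pa_schur e U i / 2)),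
         forall i, has_cond_law P (Dd i) (beta i)
           (fun x => mvnormal (UpaV i *m pa_col e U i) (x *: UpaV i)) &
         forall i, has_cond_law P (Dd i) (ell i)
           (fun x => mvnormal (- (UpaV i *m pa_col e U i)) (x *: UpaV i))]).
Proof.
move=> po pU; split=> [|alpha_gt]; first exact: chol_kernel_integrable.
split=> [|d Omega P DL lawDL].
  rewrite -(cylT R e) chol_law_cyl// big1// => i _.
  exact: block_probT.
split.
- exact: (independent_blocks pU po alpha_gt lawDL).
- exact: (law_D pU po alpha_gt lawDL).
- exact: (cond_law_beta pU po alpha_gt lawDL).
- exact: (cond_law_ell pU po alpha_gt lawDL).
Qed.
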